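(* For $4\times10^{-13}<q<1$ and all $x\in\mathbb{R}$ we have $$\pi=\sin(\pi x)\,q^{-\frac{x(x-1)}{2}}\,\frac{\log(q^{-1})\,\Gamma_q(x)\Gamma_q(1-x)}{1-q}+O\!\left(e^{\frac{\pi^2}{\log q}}\right)=\sin(\pi x)\,q^{-\frac{x(x-1)}{2}}\log(q^{-1})\prod_{k=0}^\infty\frac{(1-q^{k+1})^2}{(1-q^{k+x})(1-q^{k+1-x})}+O\!\left(e^{\frac{\pi^2}{\log q}}\right)$$ as $q\to1^-$.
   Context: For $0<q<1$, the $q$-gamma function is $\Gamma_q(x)=\frac{(q;q)_\infty}{(q^x;q)_\infty}(1-q)^{1-x}$ for $x\notin\{0,-1,-2,\dots\}$, with $(a;q)_\infty=\prod_{k=0}^\infty(1-aq^k)$. *)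

(* Defs.v *)
From mathcomp Require Import all_boot all_order all_algebra.
From mathcomp Require Import all_classical all_reals all_analysis.

Set Implicit Arguments.
Unset Strict Implicit.
Unset Printing Implicit Defensive.

Import Order.TTheory GRing.Theory Num.Theory.
Import numFieldNormedType.Exports.

Local Open Scope classical_set_scope.
Local Open Scope ring_scope.

Section QGamma.
Variable R : realType.
Implicit Types a q x y v : R.

Definition infprod (u : R^nat) : R := limn (fun n => \prod_(0 <= k < n) u k).

(* (a; q)_oo *)
Definition qpochhammer a q : R := infprod (fun k => 1 - a * q ^+ k).

(* Meaningful for 0 < q < 1 and x outside {0, -1, -2, ...}; at these poles the
   denominator vanishes and the convention 0^-1 = 0 gives a junk value. *)
Definition qgamma q x : R :=
  qpochhammer q q / qpochhammer (q `^ x) q * (1 - q) `^ (1 - x).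

Definition reflection_gamma q x : R :=
  sin (pi * x) * q `^ (- (x * (x - 1) / 2)) *
  (ln q^-1 * qgamma q x * qgamma q (1 - x) / (1 - q)).

Definition reflection_prod q x : R :=
  sin (pi * x) * q `^ (- (x * (x - 1) / 2)) * ln q^-1 *
  infprod (fun k => (1 - q `^ (k.+1%:R)) ^+ 2 /
                    ((1 - q `^ (k%:R + x)) * (1 - q `^ (k%:R + 1 - x)))).

(* v is the value at x of f extended over its removable singularities at the
   integers. Both expressions above have the form 0 * oo exactly when x is an
   integer (zero of the sine against a pole of qgamma q x * qgamma q (1 - x)),
   where they are read as the limit along y != x; elsewhere v is just f x. *)
Definition extended_value (f : R -> R) x v : Prop :=
  if x \is a Num.int then f y @[y --> x^'] --> v else v = f x.

End QGamma.

(* Main.v *)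
Require Import Defs.
From mathcomp Require Import all_boot all_order all_algebra.
From mathcomp Require Import all_classical all_reals all_analysis.
From mathcomp Require Import ring lra.

(* Write q = e^-t, x = 1/2 + s, c_k = k + 1/2 and a_m = 2 pi m / t.  The identity
     prod_k (a^2 + (c_k + s)^2) (a^2 + (c_k - s)^2) / c_k^4
       = (cosh (2 pi a) + cos (2 pi s)) / 2
   follows from 2 cosh b - 2 cos th = prod_(i < 2^j) (2 cosh (b / 2^j)
   - 2 cos ((th + 2 pi i) / 2^j)), itself iterated halving, by Tannery's theorem.
   It evaluates both the rows and the columns of the array
     (a_m^2 + (c_k + s)^2) (a_m^2 + (c_k - s)^2) / (a_m^2 + c_k^2)^2 :
   the product over all integers m gives the square of the k-th factor of the
   q-product, and the product over k is 1 + O(e^(-4 pi^2 |m| / t)) for m <> 0 and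
   cos^2 (pi s) = sin^2 (pi x) for m = 0.
   The double product converges only conditionally.  Subtracting s^2 times its value
   at s = 1 from the logarithms makes the double series absolutely convergent; the
   columns at s = 1 are trivial but the rows are not, and they produce the factor
   q^(- x (x - 1) / 2).  So on ]0, 1[ the function is constant up to a factor
   1 + O(e^(-4 pi^2 / t)).  It has period 1 and tends to pi at 0, which fixes the
   constant. *)

Set Implicit Arguments.
Unset Strict Implicit.
Unset Printing Implicit Defensive.

Import Order.TTheory GRing.Theory Num.Theory.
Import numFieldNormedType.Exports.

Local Open Scope classical_set_scope.
Local Open Scope ring_scope.

(** * Infinite products and double series *)

Section Products.
Variable R : realType.
Implicit Types (z : R^nat) (C X : R).

Lemma norm_prod1D_le z m n :
  `|\prod_(m <= k < n) (1 + z k)| <= expR (\sum_(m <= k < n) `|z k|).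
Proof.
rewrite normr_prod expR_sum; apply: ler_prod => k _; rewrite normr_ge0 /=.
by rewrite (le_trans (ler_normD _ _))// normr1 expR_ge1Dx.
Qed.

Lemma dist_prod1D_le z m n :
  `|\prod_(m <= k < n) (1 + z k) - 1| <= expR (\sum_(m <= k < n) `|z k|) - 1.
Proof.
have [nm|mn] := leqP n m; first by rewrite !big_geq// subrr normr0 expR0 subrr.
rewrite -(subnKC (ltnW mn)); elim: (n - m)%N => [|d IH].
  by rewrite addn0 !big_geq// subrr normr0 expR0 subrr.
rewrite addnS !big_nat_recr ?leq_addr//=.
set P := \prod_(_ <= _ < _) _ in IH *; set S := \sum_(_ <= _ < _) _ in IH *.
have -> : P * (1 + z (m + d)%N) - 1 = P - 1 + P * z (m + d)%N by ring.
rewrite (le_trans (ler_normD _ _))// normrM expRD.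
have hP : `|P| <= expR S by exact: norm_prod1D_le.
have := expR_ge1Dx `|z (m + d)%N|; have := normr_ge0 (z (m + d)%N).
set v := `|z _| => v0 hv.
have : `|P| * v <= expR S * v by exact: ler_wpM2r.
have : expR S * v <= expR S * (expR v - 1).
  by apply: ler_wpM2l; [exact: expR_ge0|lra].
by lra.
Qed.

(** A majorant of inverse-square size with telescoping sums: every tail bound is explicit, at most
    [1 / (m + 1)] from index [m] on. *)
Definition invS2 k : R := (k.+1%:R * k.+2%:R)^-1.

Lemma invS2_gt0 k : 0 < invS2 k.
Proof. by rewrite invr_gt0 mulr_gt0// ltr0n. Qed.

Lemma sum_invS2 m n : (m <= n)%N ->
  \sum_(m <= k < n) invS2 k = m.+1%:R^-1 - n.+1%:R^-1.
Proof.
move=> mn; rewrite -(subnKC mn); elim: (n - m)%N => [|d IH].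
  by rewrite addn0 big_geq// subrr.
rewrite addnS big_nat_recr ?leq_addr//= IH /invS2.
have h k : (k.+1%:R : R) != 0 by rewrite pnatr_eq0.
have := h (m + d).+1; have := h (m + d)%N; have := h m.
rewrite -(natr1 (m + d).+1); move: (m + d).+1%:R m.+1%:R => x y y0 x0 x1.
by field; rewrite x0 y0 x1.
Qed.

Lemma sum_invS2_le m n : \sum_(m <= k < n) invS2 k <= m.+1%:R^-1.
Proof.
have [nm|mn] := leqP n m; first by rewrite big_geq// invr_ge0 ler0n.
by rewrite sum_invS2 ?(ltnW mn)// lerBlDr lerDl invr_ge0.
Qed.

Lemma dist_cvg_le (T : Type) (F : set_system T) {FF : ProperFilter F}
    (f : T -> R) (l y e : R) :
  f @ F --> l -> (\forall n \near F, `|f n - y| <= e) -> `|l - y| <= e.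
Proof.
move=> fl fe.
have h : `|f n - y| @[n --> F] --> `|l - y|.
  by apply: cvg_norm; apply: cvgB => //; exact: cvg_cst.
exact: (cvgr_to_le h).
Qed.

Lemma cvg_quot (T : Type) (F : set_system T) {FF : Filter F} (f g : T -> R) (a b : R) :
  b != 0 -> f @ F --> a -> g @ F --> b -> f x / g x @[x --> F] --> a / b.
Proof. by move=> b0 fa gb; apply: cvgM => //; exact: cvgV. Qed.

(** The majorant does not depend on [N], so the factors from [K] on multiply to within
    [expR (|C| / (K + 1)) - 1] of 1 for every [N]. With [K] fixed, [N] tending to infinity turns the
    head into that of [g]; afterwards [K] tends to infinity. *)
Lemma tannery_prod (f : nat -> R^nat) (g : R^nat) (nu : nat -> nat) C X :
  (forall N k, (k < nu N)%N -> `|f N k - 1| <= C * invS2 k) ->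
  (forall k, f ^~ k @ \oo --> g k) ->
  (forall K, \forall N \near \oo, (K <= nu N)%N) ->
  (forall N, \prod_(0 <= k < nu N) f N k = X) ->
  (fun K => \prod_(0 <= k < K) g k) @ \oo --> X.
Proof.
move=> fle fg nuoo fX.
have bnd K N m : (K <= nu N)%N ->
    \sum_(m <= k < K) `|f N k - 1| <= `|C| / m.+1%:R.
  move=> KN; apply: (@le_trans _ _ (\sum_(m <= k < K) `|C| * invS2 k)).
    apply: ler_sum_nat => k /andP[_ kK].
    rewrite (le_trans (fle _ _ (leq_trans kK KN)))//.
    by rewrite ler_wpM2r ?ler_norm// ltW ?invS2_gt0.
  by rewrite -mulr_sumr ler_wpM2l// sum_invS2_le.
have fE N m n : \prod_(m <= k < n) f N k = \prod_(m <= k < n) (1 + (f N k - 1)).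
  by apply: eq_bigr => k _; rewrite addrC subrK.
have key K : `|\prod_(0 <= k < K) g k - X| <=
    expR `|C| * (expR (`|C| / K.+1%:R) - 1).
  apply: (@dist_cvg_le _ \oo _ (fun N => \prod_(0 <= k < K) f N k)).
    elim: (K) => [|K0 IH].
      rewrite big_geq//; under eq_fun do rewrite big_geq//.
      exact: cvg_cst.
    rewrite big_nat_recr//=; under eq_fun do rewrite big_nat_recr//=.
    by apply: cvgM => //; exact: fg.
  near=> N.
  have KN : (K <= nu N)%N by near: N; exact: nuoo.
  (* Since [X] is head times tail, the difference is the head times one minus the tail; each is
     bounded through the exponential of a tail sum. *)
  rewrite -(fX N) (big_cat_nat _ KN)//=.
  rewrite -{1}[\prod_(0 <= k < K) _]mulr1 -mulrBr normrM distrC.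
  apply: ler_pM => //; rewrite fE.
    rewrite (le_trans (norm_prod1D_le _ _ _))// ler_expR.
    by rewrite (le_trans (bnd _ _ _ KN))// divr1.
  rewrite (le_trans (dist_prod1D_le _ _ _))// lerB// ler_expR.
  exact: bnd.
apply/cvgrPdist_le => e e0.
have : (fun K : nat => expR `|C| * (expR (`|C| / K.+1%:R) - 1)) @ \oo --> (0 : R).
  have h : (fun K : nat => expR (`|C| / K.+1%:R)) @ \oo --> (1 : R).
    rewrite -[X in _ --> X]expR0 -(mulr0 `|C|).
    apply: continuous_cvg; first exact: continuous_expR.
    by apply: (cvgM (cvg_cst _)); exact: cvg_harmonic.
  rewrite -(mulr0 (expR `|C|)) -(subrr 1); apply: (cvgM (cvg_cst _)).
  by apply: cvgB => //; exact: cvg_cst.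
move/cvgrPdist_le => /(_ e e0); apply: filterS => K.
rewrite sub0r normrN => h; rewrite distrC (le_trans (key K))//.
by rewrite (le_trans (ler_norm _)).
Unshelve. all: by end_near.
Qed.

(** The majorant has product form, so cutting the rows at [M] costs at most [C / (M + 1)], whatever
    the number [K] of rows. This uniformity survives the limits in the row length and then in
    [K]. *)
Lemma double_sum_cvg (B : nat -> R^nat) (r y : R^nat) C X :
  (forall k m, `|B k m| <= C * invS2 k * invS2 m) ->
  (forall k, (fun M => \sum_(0 <= m < M) B k m) @ \oo --> r k) ->
  (forall m, (fun K => \sum_(0 <= k < K) B k m) @ \oo --> y m) ->
  (fun K => \sum_(0 <= k < K) r k) @ \oo --> X ->
  (fun M => \sum_(0 <= m < M) y m) @ \oo --> X.
Proof.
move=> Ble Br By rX.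
have C0 : 0 <= C.
  have := le_trans (normr_ge0 _) (Ble 0%N 0%N).
  by rewrite -mulrA pmulr_lge0// mulr_gt0 ?invS2_gt0.
have cvgsum (h : nat -> R^nat) (l : R^nat) n :
    (forall i, h i @ \oo --> l i) ->
    (fun N => \sum_(0 <= i < n) h i N) @ \oo --> \sum_(0 <= i < n) l i.
  move=> hl; elim: n => [|n IH].
    rewrite big_geq//; under eq_fun do rewrite big_geq//.
    exact: cvg_cst.
  rewrite big_nat_recr//=; under eq_fun do rewrite big_nat_recr//=.
  by apply: cvgD => //; exact: hl.
have tail K M M' : (M <= M')%N ->
    `|\sum_(0 <= k < K) \sum_(0 <= m < M') B k m -
      \sum_(0 <= k < K) \sum_(0 <= m < M) B k m| <= C / M.+1%:R.
  move=> MM; rewrite -sumrB.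
  under eq_bigr do rewrite (big_cat_nat _ MM)//= addrAC subrr add0r.
  rewrite (le_trans (ler_norm_sum _ _ _))//.
  apply: (@le_trans _ _ (\sum_(0 <= k < K) (C / M.+1%:R) * invS2 k)).
    apply: ler_sum => k _; rewrite (le_trans (ler_norm_sum _ _ _))//.
    apply: (@le_trans _ _ (\sum_(M <= m < M') C * invS2 k * invS2 m)).
      by apply: ler_sum => m _; exact: Ble.
    rewrite -mulr_sumr mulrAC ler_wpM2r ?(ltW (invS2_gt0 _))//.
    by rewrite ler_wpM2l// sum_invS2_le.
  rewrite -mulr_sumr ler_piMr ?mulr_ge0//.
  by rewrite (le_trans (sum_invS2_le _ _))// invr1.
have key M : `|\sum_(0 <= m < M) y m - X| <= C / M.+1%:R.
  have h K : `|\sum_(0 <= k < K) r k - \sum_(0 <= k < K) \sum_(0 <= m < M) B k m|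
      <= C / M.+1%:R.
    apply: (@dist_cvg_le _ \oo _ (fun M' => \sum_(0 <= k < K) \sum_(0 <= m < M') B k m)).
      exact: cvgsum.
    by near=> M'; apply: tail; near: M'; exact: nbhs_infty_ge.
  have hl : (fun K => \sum_(0 <= k < K) \sum_(0 <= m < M) B k m -
       \sum_(0 <= k < K) r k) @ \oo --> \sum_(0 <= m < M) y m - X.
    apply: cvgB => //; under eq_fun do rewrite exchange_big_nat//=.
    exact: cvgsum.
  rewrite -[X in `|X|]subr0; apply: (dist_cvg_le hl).
  by near=> K; rewrite subr0 distrC.
apply/cvgrPdist_le => e e0.
have : (fun M : nat => C / M.+1%:R) @ \oo --> (0 : R).
  by rewrite -(mulr0 C); apply: (cvgM (cvg_cst _)); exact: cvg_harmonic.
move/cvgrPdist_le => /(_ e e0); apply: filterS => M.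
rewrite sub0r normrN => h; rewrite distrC (le_trans (key M))//.
by rewrite (le_trans (ler_norm _)).
Unshelve. all: by end_near.
Qed.

End Products.

(** * The product for cosh - cos *)

Section CoshCosProduct.
Variable R : realType.
Implicit Types a b c s x th : R.

Definition coshBcos b th : R := expR b + expR (- b) - 2 * cos th.

(** A difference of squares: the shift by pi changes the sign of the cosine, and the duplication
    formulas of cosh and cos do the rest. *)
Lemma coshBcos_half b th :
  coshBcos b th = coshBcos (b / 2) (th / 2) * coshBcos (b / 2) (th / 2 + pi).
Proof.
rewrite /coshBcos cosDpi; have -> : cos th = cos (th / 2) ^+ 2 *+ 2 - 1.
  by rewrite -cos_mulr2n -[th / 2 *+ 2]mulr_natr divfK// pnatr_eq0.
have -> : expR b = expR (b / 2) ^+ 2.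
  by rewrite -expRM_natr divfK// pnatr_eq0.
have -> : expR (- b) = expR (- (b / 2)) ^+ 2.
  by rewrite -expRM_natr mulNr divfK// pnatr_eq0.
have := expRxMexpNx_1 (b / 2).
move: (expR _) (expR _) (cos _) => u v w uv.
by ring: uv.
Qed.

Lemma coshBcos_prod b th j : coshBcos b th =
  \prod_(0 <= i < 2 ^ j) coshBcos (b / 2 ^+ j) ((th + 2 * pi * i%:R) / 2 ^+ j).
Proof.
elim: j => [|j IH].
  by rewrite expn0 big_nat1 !expr0 !divr1 mulr0 addr0.
have n0 : (2 ^+ j : R) != 0 by rewrite expf_neq0// pnatr_eq0.
(* Halving sends the factor [i] of level [j] to the factors [i] and [i + 2 ^ j] of level [j + 1],
   since adding pi to the halved angle adds [2 ^ j] to [i]. *)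
rewrite expnS mul2n -addnn (big_cat_nat (leq0n (2 ^ j)) (leq_addl _ _))/=.
rewrite (big_addn 0 _ (2 ^ j)) addnK -big_split/= IH.
apply: eq_bigr => i _; rewrite coshBcos_half exprS natrD natrX.
congr (coshBcos _ _ * coshBcos _ _); first by field.
- by field.
- by field.
by field.
Qed.

Definition half_int k : R := k%:R + 2^-1.

Lemma half_int_gt0 k : 0 < half_int k. Proof. by rewrite ltr_wpDl. Qed.

(** The extra pi centres the angles at half-integers. Reading the upper half of the indices
    backwards turns its angles, up to sign and a full turn, into those with [- s], which pairs them
    with the lower half. *)
Lemma coshBcos_prod_sym b s j : coshBcos b (2 * pi * s + pi) =
  \prod_(0 <= k < 2 ^ j)
    (coshBcos (b / 2 ^+ j.+1) (2 * (pi / 2 ^+ j.+1 * (half_int k + s))) *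
     coshBcos (b / 2 ^+ j.+1) (2 * (pi / 2 ^+ j.+1 * (half_int k - s)))).
Proof.
have n0 : (2 ^+ j : R) != 0 by rewrite expf_neq0// pnatr_eq0.
rewrite (coshBcos_prod _ _ j.+1) expnS mul2n -addnn (big_cat_nat (leq0n (2 ^ j)) (leq_addl _ _))/=.
rewrite (big_addn 0 _ (2 ^ j)) addnK [X in _ * X]big_nat_rev/= -big_split/=.
apply: eq_big_nat => k /andP[_ kj]; congr (_ * _).
  by congr coshBcos; rewrite /half_int exprS; field.
rewrite /coshBcos; congr (_ - 2 * _).
rewrite -[RHS]cosN -[RHS](cosD2pi); congr cos.
rewrite add0n natrD (natrB _ kj) natrX -natr1 /half_int exprS.
by rewrite -[pi *+ 2]mulr_natr; field.
Qed.

Lemma coshBcosE b th :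
  coshBcos (2 * b) (2 * th) = (expR b - expR (- b)) ^+ 2 + 4 * sin th ^+ 2.
Proof.
rewrite /coshBcos !mulr_natl cos_mulr2n cos2sin2 -mulr_natl -mulrN !mulr_natl
  -[b *+ 2]mulr_natr -[(- b) *+ 2]mulr_natr.
rewrite !expRM_natr.
have := expRxMexpNx_1 b.
move: (expR _) (expR _) (sin _) => u v w uv.
by ring: uv.
Qed.

Lemma sin_le_id x : 0 <= x -> sin x <= x.
Proof.
move=> x0; have [|y _] := @MVT_segment R sin cos 0 x x0.
  by apply: continuous_subspaceT => w; exact: continuous_sin.
by rewrite sin0 !subr0 => ->; rewrite ler_piMl// cos_le1.
Qed.

Lemma sin_sqr_le x : sin x ^+ 2 <= x ^+ 2.
Proof.
wlog x0 : x / 0 <= x.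
  move=> h; have [/h//|/ltW x0] := leP 0 x.
  by rewrite -sqrrN -[leRHS]sqrrN -sinN; apply: h; rewrite oppr_ge0.
have [x1|/ltW x1] := leP x 1.
  rewrite lerXn2r ?nnegrE ?sin_le_id// sin_ge0_pi// x0 (le_trans x1)//.
  by rewrite (le_trans _ (pi_ge2 R))// ler1n.
by rewrite (le_trans _ (exprn_ege1 2 x1))// sin2cos2 lerBlDr lerDl sqr_ge0.
Qed.

(** A weak Jordan inequality. With [x = 2 y], the mean value theorem gives [sin y >= y * cos y],
    hence [sin x >= 2 * y * cos y ^+ 2], and [2 * cos y ^+ 2 = 1 + cos x >= 1]. *)
Lemma sin_ge_half x : 0 <= x <= pi / 2 -> x / 2 <= sin x.
Proof.
move=> /andP[x0 xp]; set y := x / 2.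
have pi0 := pi_gt0 R.
have y0 : 0 <= y by rewrite divr_ge0.
have yp : y <= pi by rewrite /y; lra.
have [|z] := @MVT_segment R sin cos 0 y y0.
  by apply: continuous_subspaceT => w; exact: continuous_sin.
rewrite in_itv/= sin0 !subr0 => /andP[z0 zy] sy.
have cyz : cos y <= cos z.
  have [->//|zny] := eqVneq z y.
  by rewrite ltW// ltr_cos ?in_itv/= ?y0 ?z0 ?yp ?(le_trans zy yp)// lt_neqAle zny.
have xE : x = y *+ 2 by rewrite -[RHS]mulr_natr /y divfK// pnatr_eq0.
have cx : 0 <= cos x by apply: cos_ge0_pihalf; rewrite xp andbT; lra.
have cy : 0 <= cos y by apply: cos_ge0_pihalf; rewrite /y; apply/andP; split; lra.
have c2 : 1 <= cos y ^+ 2 *+ 2 by move: cx; rewrite xE cos_mulr2n; lra.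
rewrite xE sin_mulr2n sy.
have h : cos y * y <= cos z * y by exact: ler_wpM2r.
have h2 : cos y * (cos y * y) <= cos y * (cos z * y) by exact: ler_wpM2l.
have h3 : 1 * y <= cos y ^+ 2 *+ 2 * y by exact: ler_wpM2r.
rewrite mulr2n; move: h3; rewrite expr2 mulr2n mulrDl -!mulrA; lra.
Qed.

Lemma sinh_sqr_le x : (expR x - expR (- x)) ^+ 2 <= 4 * x ^+ 2 * expR (2 * `|x|).
Proof.
wlog x0 : x / 0 <= x.
  move=> h; have [/h//|/ltW x0] := leP 0 x.
  have := h (- x); rewrite opprK normrN sqrrN oppr_ge0 => /(_ x0).
  by rewrite -[in leLHS]opprB sqrrN.
rewrite ger0_norm// mulrC (_ : 4 * x ^+ 2 = (2 * x) ^+ 2); last by ring.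
rewrite [in X in X * _]mulrC expRM_natr -exprMn lerXn2r ?nnegrE//.
- by rewrite subr_ge0 ler_expR lerNl; lra.
- by rewrite mulr_ge0 ?expR_ge0// mulr_ge0.
have -> : expR (- x) = expR x * expR (- (2 * x)) by rewrite -expRD; congr expR; ring.
rewrite -{1}[expR x]mulr1 -mulrBr ler_wpM2l ?expR_ge0//.
by have := expR_ge1Dx (- (2 * x)); lra.
Qed.

Lemma cvg_diff_quotient (f : R -> R) (d : R) : f 0 = 0 -> is_derive (0 : R) 1 f d ->
  h^-1 * f h @[h --> 0^'] --> d.
Proof.
move=> f0 [df <-]; rewrite /derive /=.
have := df; rewrite /derivable => /cvg_ex[l hl].
rewrite (cvg_lim _ hl)//.
apply: cvg_trans hl; apply: near_eq_cvg; near=> h.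
by rewrite /= addr0 f0 subr0 /GRing.scale /= mulr1.
Unshelve. all: by end_near.
Qed.

Lemma cvg_dnbhs0 (e : R^nat) : (forall n, e n != 0) -> e @ \oo --> 0 -> e @ \oo --> 0^'.
Proof.
move=> en e0 P [r /= r0 rP].
have : \forall n \near \oo, ball 0 r (e n) by exact: (e0 _ (nbhsx_ballx _ _ r0)).
by apply: filterS => n en0; exact: (rP _ en0 (en n)).
Qed.

End CoshCosProduct.

(** * The limit of the finite products as the mesh tends to 0 *)

Section CoshCosLimit.
Variable R : realType.
Implicit Types a s x v : R.

Definition mesh (N : nat) : R := pi / 2 ^+ N.+1.
Definition sinh_mesh a N : R := (expR (mesh N * a) - expR (- (mesh N * a))) / 2.
Definition mesh_factor a s N k : R :=
  (sinh_mesh a N ^+ 2 + sin (mesh N * (half_int R k + s)) ^+ 2) *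
  (sinh_mesh a N ^+ 2 + sin (mesh N * (half_int R k - s)) ^+ 2) / sin (mesh N * half_int R k) ^+ 4.

Lemma mesh_gt0 N : 0 < mesh N.
Proof. by rewrite divr_gt0 ?pi_gt0// exprn_gt0. Qed.

Lemma mesh_le2 N : mesh N <= 2.
Proof.
rewrite ler_pdivrMr ?exprn_gt0// -exprS.
have := pihalf_lt2 R; rewrite ltr_pdivrMr// => /ltW/le_trans; apply.
by rewrite -expr2 ler_eXn2l ?ltr1n.
Qed.

Lemma mesh_half N k : (k < 2 ^ N)%N -> 0 <= mesh N * half_int R k <= pi / 2.
Proof.
move=> kN; have h0 := half_int_gt0 R k; have e0 := mesh_gt0 N.
have e2 : mesh N * 2 ^+ N = pi / 2.
  by rewrite /mesh exprS invfM mulrA mulfVK// expf_neq0.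
rewrite (mulr_ge0 (ltW e0) (ltW h0))/= -e2; apply: ler_wpM2l; first exact: ltW.
have : k.+1%:R <= (2 ^ N)%:R :> R by rewrite ler_nat.
by rewrite natrX -natr1 /half_int; lra.
Qed.

Lemma cvg_mesh : mesh @ \oo --> 0.
Proof.
rewrite -(mulr0 pi); apply: (cvgM (cvg_cst _)).
under eq_fun do rewrite -exprVn.
have : (GRing.exp (2^-1 : R) : R^nat) @ \oo --> 0.
  by apply: cvg_expr; rewrite ger0_norm ?invr_ge0// invf_lt1// ltr1n.
by rewrite -cvg_shiftS.
Qed.

Lemma cvg_mesh_dnbhs : mesh @ \oo --> 0^'.
Proof. by apply: cvg_dnbhs0 cvg_mesh => n; rewrite gt_eqF ?mesh_gt0. Qed.

Lemma is_derive_mulr_const x v : is_derive x 1 (fun h : R => h * v) v.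
Proof.
rewrite (_ : (fun h => _) = v *: id); last first.
  by apply/funext => h /=; rewrite mulrC.
by apply: is_derive_eq; rewrite /GRing.scale/= mulr1.
Qed.

Lemma cvg_sin_mesh v : (fun N => (mesh N)^-1 * sin (mesh N * v)) @ \oo --> v.
Proof.
have h : h^-1 * sin (h * v) @[h --> (0 : R)^'] --> v.
  apply: (@cvg_diff_quotient _ (fun h => sin (h * v))); first by rewrite mul0r sin0.
  have := @is_derive1_comp _ _ ( *%R^~ v) 0 _ _ (is_derive_sin (0 * v)) (is_derive_mulr_const 0 v).
  by rewrite mul0r cos0 mul1r.
exact: (cvg_comp _ _ cvg_mesh_dnbhs h).
Qed.

Lemma cvg_sinh_mesh a : (fun N => (mesh N)^-1 * sinh_mesh a N) @ \oo --> a.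
Proof.
have h : h^-1 * ((expR (h * a) - expR (- (h * a))) / 2) @[h --> (0 : R)^'] --> a.
  apply: (@cvg_diff_quotient _ (fun h => (expR (h * a) - expR (- (h * a))) / 2)).
    by rewrite mul0r oppr0 subrr mul0r.
  have h1 := @is_derive1_comp _ _ ( *%R^~ a) 0 _ _ (is_derive_expR (0 * a))
    (is_derive_mulr_const 0 a).
  have h2 := @is_derive1_comp _ _ ( *%R^~ (- a)) 0 _ _ (is_derive_expR (0 * - a))
    (is_derive_mulr_const 0 (- a)).
  rewrite (_ : (fun h => _) =
    2^-1 \*: ((expR \o *%R^~ a) - (expR \o *%R^~ (- a)))); last first.
    by apply/funext => h; rewrite mulrC -mulrN.
  apply: is_derive_eq (is_deriveZ 2^-1 (is_deriveB h1 h2)) _.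
  by rewrite !mul0r expR0 !mul1r /GRing.scale/=; field.
exact: (cvg_comp _ _ cvg_mesh_dnbhs h).
Qed.

Lemma cvg_mesh_factor a s k : mesh_factor a s ^~ k @ \oo -->
  (a ^+ 2 + (half_int R k + s) ^+ 2) * (a ^+ 2 + (half_int R k - s) ^+ 2) / half_int R k ^+ 4.
Proof.
have sc v : (fun N => ((mesh N)^-1 * sin (mesh N * v)) ^+ 2) @ \oo --> v ^+ 2.
  by under eq_fun do rewrite expr2; rewrite expr2; apply: cvgM; exact: cvg_sin_mesh.
have hc : (fun N => ((mesh N)^-1 * sinh_mesh a N) ^+ 2) @ \oo --> a ^+ 2.
  by under eq_fun do rewrite expr2; rewrite expr2; apply: cvgM; exact: cvg_sinh_mesh.
have c0 : half_int R k != 0 by rewrite gt_eqF// half_int_gt0.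
(* Numerator and denominator both have degree 4 in the sines and sinh, so each of these can be
   divided by the mesh, after which it has a limit. *)
rewrite (_ : mesh_factor a s ^~ k = fun N =>
    (((mesh N)^-1 * sinh_mesh a N) ^+ 2 +
     ((mesh N)^-1 * sin (mesh N * (half_int R k + s))) ^+ 2) *
    (((mesh N)^-1 * sinh_mesh a N) ^+ 2 +
     ((mesh N)^-1 * sin (mesh N * (half_int R k - s))) ^+ 2) /
    (((mesh N)^-1 * sin (mesh N * half_int R k)) ^+ 2 *
     ((mesh N)^-1 * sin (mesh N * half_int R k)) ^+ 2)); last first.
  apply/funext => N; rewrite /mesh_factor.
  have e0 : mesh N != 0 by rewrite gt_eqF// mesh_gt0.
  move: (sinh_mesh a N) (sin _) (sin _) (sin _) => u v w z.
  (* A zero sine in the denominator makes both sides 0 by the convention [0^-1 = 0]. *)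
  have [->|v0] := eqVneq v 0.
    by rewrite !mulr0 !expr0n/= mulr0 !invr0 !mulr0.
  by field; rewrite e0 v0.
rewrite (_ : half_int R k ^+ 4 = half_int R k ^+ 2 * half_int R k ^+ 2); last by rewrite -exprD.
apply: cvgM.
  by apply: cvgM; apply: cvgD; [exact: hc|exact: sc|exact: hc|exact: sc].
by apply: cvgV; [rewrite mulf_neq0// expf_neq0|apply: cvgM; exact: sc].
Qed.

(** The constant 8 is the one that gives equality at [k = 0]. *)
Lemma inv_half_int_sqr_le k : (8 * half_int R k ^+ 2)^-1 <= invS2 R k.
Proof.
have h0 := half_int_gt0 R k.
rewrite lef_pV2 ?posrE ?mulr_gt0 ?exprn_gt0//.
have k0 : 0 <= k%:R :> R by rewrite ler0n.
rewrite -[k.+2%:R]natr1 -[k.+1%:R]natr1 /half_int; nra.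
Qed.

(** The majorant for [tannery_prod]. In [K], the factor 4 comes from [sin_ge_half], applicable
    because [k < 2 ^ N] keeps the angle in the first quadrant; the exponent [4 * |a|] comes from
    [sinh_sqr_le] and a mesh of at most 2. *)
Lemma dist_mesh_factor a s N k : (k < 2 ^ N)%N ->
  let K := 4 * (a ^+ 2 * expR (4 * `|a|) + s ^+ 2) in
  `|mesh_factor a s N k - 1| <= 8 * K * (16 * K + 4) * invS2 R k.
Proof.
move=> kN /=; set K := 4 * (_ + _); have h0 := half_int_gt0 R k; have e0 := mesh_gt0 N.
set c := half_int R k in h0; set e := mesh N in e0.
have K0 : 0 <= K.
  by apply: mulr_ge0 => //; apply: addr_ge0; rewrite ?sqr_ge0// mulr_ge0 ?sqr_ge0 ?expR_ge0.
pose y := sin (e * c) ^+ 2; pose t := sin (e * s) ^+ 2; pose u := sinh_mesh a N ^+ 2.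
have y_ge : (e * c) ^+ 2 / 4 <= y.
  rewrite (_ : _ / 4 = (e * c / 2) ^+ 2); last by field.
  have /andP[ec0 ec1] := mesh_half kN.
  rewrite lerXn2r ?nnegrE ?divr_ge0//; last by apply: sin_ge_half; rewrite ec0.
  by apply: sin_ge0_pi; rewrite ec0 (le_trans ec1)// ler_pdivrMr// ler_peMr ?pi_ge0// ler1n.
have y0 : 0 < y by rewrite (lt_le_trans _ y_ge)// divr_gt0// exprn_gt0// mulr_gt0.
have y1 : y <= 1 by rewrite /y sin2cos2 lerBlDr lerDl sqr_ge0.
have u_le : u <= e ^+ 2 * (a ^+ 2 * expR (4 * `|a|)).
  rewrite /u /sinh_mesh expr_div_n ler_pdivrMr ?exprn_gt0//.
  rewrite (le_trans (sinh_sqr_le _))// exprMn.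
  rewrite (_ : 4 * (e ^+ 2 * a ^+ 2) * expR (2 * `|mesh N * a|) =
    e ^+ 2 * (a ^+ 2 * expR (2 * `|mesh N * a|)) * 2 ^+ 2); last by ring.
  rewrite ler_wpM2r ?exprn_ge0// !ler_wpM2l ?sqr_ge0// ler_expR.
  rewrite normrM (gtr0_norm e0) mulrA ler_wpM2r// (_ : 4 = 2 * 2) ?ler_wpM2l ?mesh_le2//.
  by ring.
have t_le : t <= e ^+ 2 * s ^+ 2 by rewrite -exprMn sin_sqr_le.
have u0 : 0 <= u by exact: sqr_ge0.
have t0 : 0 <= t by exact: sqr_ge0.
have c2 : 4^-1 <= c ^+ 2.
  have k0 : 0 <= k%:R :> R by rewrite ler0n.
  by rewrite /c /half_int; nra.
have frac v w : v <= e ^+ 2 * w -> 4 * w <= K -> v / y <= K / c ^+ 2.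
  move=> vw wK; rewrite ler_pdivrMr// mulrAC ler_pdivlMr ?exprn_gt0//.
  have : v * c ^+ 2 <= e ^+ 2 * w * c ^+ 2 by rewrite ler_wpM2r// sqr_ge0.
  have : K * ((e * c) ^+ 2 / 4) <= K * y by rewrite ler_wpM2l.
  have : 4 * w * (e * c) ^+ 2 <= K * (e * c) ^+ 2 by rewrite ler_wpM2r// sqr_ge0.
  rewrite exprMn; lra.
have s20 := sqr_ge0 s; have a20 := sqr_ge0 a.
have pK : u / y <= K / c ^+ 2.
  by apply: frac u_le _; rewrite /K mulrDr lerDl mulr_ge0.
have rK : t / y <= K / c ^+ 2.
  by apply: frac t_le _; rewrite /K mulrDr lerDr; do 2!apply: mulr_ge0 => //; exact: expR_ge0.
(* The addition formulas make the factor a polynomial in [y] and the ratios [u / y] and [t / y]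
   without the cosines, which enter only squared; every term after subtracting 1 contains one of the
   ratios. *)
have facE : mesh_factor a s N k - 1 = (u / y) ^+ 2 + 2 * (u / y) +
    2 * (u / y) * (t / y) * (1 - 2 * y) - 2 * (t / y) + (t / y) ^+ 2.
  rewrite /mesh_factor -/c -/e [e * (c + s)]mulrDr [e * (c - s)]mulrBr sinD sinB.
  have := cos2sin2 (e * c); have := cos2sin2 (e * s).
  rewrite -/y -/t -/u.
  rewrite (_ : sin (e * c) ^+ 4 = y ^+ 2); last by rewrite /y -exprM.
  move: (cos (e * s)) (cos (e * c)) => C D; move: y0; rewrite /y /t.
  move: (sin (e * c)) (sin (e * s)) => A B; move: (u) => v.
  move=> A0 CB DA; have {}A0 : A != 0 by apply: contraTN A0 => /eqP->; rewrite expr0n ltxx.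
  rewrite (_ : (v + (A * C + D * B) ^+ 2) * (v + (A * C - D * B) ^+ 2) =
    v ^+ 2 + 2 * v * (A ^+ 2 * C ^+ 2 + D ^+ 2 * B ^+ 2) +
    (A ^+ 2 * C ^+ 2 - D ^+ 2 * B ^+ 2) ^+ 2); last by ring.
  by rewrite CB DA; field.
have p0 : 0 <= u / y by rewrite divr_ge0// ltW.
have r0 : 0 <= t / y by rewrite divr_ge0// ltW.
have KK : K / c ^+ 2 <= 4 * K.
  by rewrite ler_pdivrMr ?exprn_gt0// -mulrA [4 * _]mulrC -mulrA ler_peMr//; lra.
have cinv : (c ^+ 2)^-1 <= 8 * invS2 R k.
  by have := inv_half_int_sqr_le k; rewrite -/c invfM ler_pdivrMl.
rewrite facE.
(* Both ratios are at most [L = K / c ^+ 2 <= 4 * K]. The quadratic terms contribute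
   [4 + 4 + 8 = 16] times [K * L], the two linear ones [4 * L]. *)
apply: (@le_trans _ _ (K / c ^+ 2 * (16 * K + 4))); last first.
  have : K * (c ^+ 2)^-1 * (16 * K + 4) <= K * (8 * invS2 R k) * (16 * K + 4).
    by rewrite ler_wpM2r ?ler_wpM2l// addr_ge0// mulr_ge0.
  lra.
move: (u / y) (t / y) (K / c ^+ 2) p0 r0 pK rK KK => p r L p0 r0 pL rL LK.
have L0 : 0 <= L by lra.
have pp : p ^+ 2 <= 4 * K * L by rewrite expr2; apply: ler_pM => //; lra.
have rr : r ^+ 2 <= 4 * K * L by rewrite expr2; apply: ler_pM => //; lra.
have pr : p * r <= 4 * K * L by apply: ler_pM => //; lra.
have pr0 : 0 <= p * r by rewrite mulr_ge0.
have y2 : `|1 - 2 * y| <= 1 by rewrite ler_norml; lra.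
have : `|2 * p * r * (1 - 2 * y)| <= 2 * (p * r) * 1.
  by rewrite normrM ger0_norm -?mulrA ?mulr_ge0// ?ler_wpM2l ?mulr_ge0.
rewrite mulr1 ler_norml => /andP[z1 z2].
have := sqr_ge0 p; have := sqr_ge0 r.
rewrite ler_norml; lra.
Qed.

Lemma coshcos_prod a s :
  (fun K => \prod_(0 <= k < K) ((a ^+ 2 + (half_int R k + s) ^+ 2) *
     (a ^+ 2 + (half_int R k - s) ^+ 2) / half_int R k ^+ 4)) @ \oo -->
  (expR (2 * pi * a) + expR (- (2 * pi * a)) + 2 * cos (2 * pi * s)) / 4.
Proof.
pose C := 4 * (a ^+ 2 * expR (4 * `|a|) + s ^+ 2).
apply: (@tannery_prod R (mesh_factor a s) _ (fun N => 2 ^ N)%N (8 * C * (16 * C + 4))).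
- by move=> N k; exact: dist_mesh_factor.
- by move=> k; exact: cvg_mesh_factor.
- move=> K; near=> N; rewrite (leq_trans _ (ltnW (ltn_expl _ _)))//.
  by near: N; exact: nbhs_infty_ge.
move=> N.
(* The case [a = s = 0] of the finite product evaluates the product of the denominators:
   [2 - 2 * cos pi = 4]. *)
have prod_sin : \prod_(0 <= k < 2 ^ N) (4 * sin (mesh N * half_int R k) ^+ 2) ^+ 2 = 4.
  transitivity (coshBcos (0 : R) (2 * pi * 0 + pi)).
    rewrite (coshBcos_prod_sym _ _ N); apply: eq_bigr => k _.
    by rewrite mul0r addr0 subr0 -expr2 -[X in coshBcos X](mulr0 2) coshBcosE
      oppr0 expR0 subrr expr0n add0r.
  by rewrite mulr0 add0r /coshBcos oppr0 expR0 cospi; ring.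
transitivity (coshBcos (2 * pi * a) (2 * pi * s + pi) / 4); last first.
  by rewrite /coshBcos cosDpi mulrN opprK.
rewrite -prod_sin (coshBcos_prod_sym _ _ N) -prodf_div.
apply: eq_big_nat => k /andP[_ kN].
have /andP[_ ec1] := mesh_half kN.
have sn0 : sin (mesh N * half_int R k) != 0.
  rewrite gt_eqF// sin_gt0_pi// mulr_gt0 ?mesh_gt0 ?half_int_gt0//= (le_lt_trans ec1)//.
  by rewrite ltr_pdivrMr// ltr_pMr ?pi_gt0// ltr1n.
have -> : 2 * pi * a / 2 ^+ N.+1 = 2 * (mesh N * a) by rewrite /mesh; field; rewrite expf_neq0.
rewrite !coshBcosE /mesh_factor -/(mesh N).
have -> : expR (mesh N * a) - expR (- (mesh N * a)) = 2 * sinh_mesh a N.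
  by rewrite /sinh_mesh; field.
move: (sinh_mesh a N) (sin _) (sin _) (sin _) sn0 => u v w z z0.
by field.
Unshelve. all: by end_near.
Qed.

End CoshCosLimit.

(** * Summation of the double array *)

Section Interchange.
Variable R : realType.
Implicit Types a c d s t u x z : R.

Lemma ln_prod (I : Type) (r : seq I) (P : pred I) (F : I -> R) :
  (forall i, P i -> 0 < F i) ->
  ln (\prod_(i <- r | P i) F i) = \sum_(i <- r | P i) ln (F i).
Proof.
move=> F0; elim: r => [|i r IH]; first by rewrite !big_nil ln1.
rewrite !big_cons; case: ifPn => // Pi.
by rewrite lnM ?posrE ?F0 ?IH// prodr_gt0.
Qed.

Lemma dist_ln1D z d : 0 < d -> d <= 1 + z -> `|ln (1 + z) - z| <= z ^+ 2 / d.
Proof.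
move=> d0 dz; have z1 : 0 < 1 + z by exact: lt_le_trans dz.
have h1 : ln (1 + z) <= z by apply: le_ln1Dx; lra.
have h2 : - ln (1 + z) <= (1 + z)^-1 - 1.
  rewrite -lnV ?posrE// -{1}[(1 + z)^-1](subrK 1) addrC.
  by apply: le_ln1Dx; rewrite ltrBDl subrr invr_gt0.
have h3 : z ^+ 2 / (1 + z) <= z ^+ 2 / d.
  by rewrite ler_wpM2l ?sqr_ge0// lef_pV2 ?posrE.
have h4 : z ^+ 2 / (1 + z) = z + ((1 + z)^-1 - 1) by field; rewrite gt_eqF.
rewrite ler0_norm; lra.
Qed.

Definition sym_ratio c a s : R :=
  (a ^+ 2 + (c + s) ^+ 2) * (a ^+ 2 + (c - s) ^+ 2) / (a ^+ 2 + c ^+ 2) ^+ 2.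

Lemma sym_ratio_gt0 c a s : 0 < c -> c + s != 0 -> c - s != 0 -> 0 < sym_ratio c a s.
Proof.
move=> c0 cs1 cs2.
have h w : w != 0 -> 0 < a ^+ 2 + w ^+ 2.
  by move=> w0; rewrite ltr_wpDl ?sqr_ge0// lt0r sqr_ge0 expf_neq0.
by rewrite divr_gt0 ?mulr_gt0 ?exprn_gt0 ?h// gt_eqF.
Qed.

(** With [D = a ^+ 2 + c ^+ 2], the ratio is exactly [1 + z], where [z] is the subtracted fraction
    and [|z| <= 6 / D]: 2 from the term in [s ^+ 2], 4 from [s ^+ 4] because [D >= 1 / 4]. The
    conditions on [d] keep [1 + z] above [d ^+ 4], so [dist_ln1D] applies. *)
Lemma dist_ln_sym_ratio c a s d : 2^-1 <= c -> `|s| <= 1 -> 0 < d <= 1 ->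
  d * c <= `|c + s| -> d * c <= `|c - s| ->
  `|ln (sym_ratio c a s) -
    (s ^+ 2 * (2 * (a ^+ 2 - c ^+ 2)) + s ^+ 4) / (a ^+ 2 + c ^+ 2) ^+ 2| <=
  36 / d ^+ 4 / (a ^+ 2 + c ^+ 2) ^+ 2.
Proof.
move=> c2 s1 /andP[d0 d1] dcs1 dcs2.
have c0 : 0 < c by lra.
have a20 := sqr_ge0 a.
have c20 : 4^-1 <= c ^+ 2 by nra.
set D := a ^+ 2 + c ^+ 2; have D4 : 4^-1 <= D by rewrite /D; lra.
have D0 : 0 < D by lra.
set z := (_ + s ^+ 4) / D ^+ 2.
have zE : sym_ratio c a s = 1 + z.
  by rewrite /sym_ratio /z /D; field; rewrite -/D gt_eqF.
have s2 : s ^+ 2 <= 1 by rewrite -real_normK ?num_real// expr_le1.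
have s20 := sqr_ge0 s.
have zle : `|z| <= 6 / D.
  rewrite normrM [X in _ * X]gtr0_norm ?invr_gt0 ?exprn_gt0//.
  rewrite ler_pdivrMr ?exprn_gt0//.
  rewrite (_ : 6 / D * D ^+ 2 = 6 * D); last by field; rewrite gt_eqF.
  have h : `|a ^+ 2 - c ^+ 2| <= D by rewrite ler_norml /D; apply/andP; split; nra.
  rewrite (le_trans (ler_normD _ _))// [`|s ^+ 2 * _|]normrM (ger0_norm s20)
    [`|2 * _|]normrM [`|2|]ger0_norm//.
  rewrite (ger0_norm (_ : 0 <= s ^+ 4)); last by rewrite (exprM s 2 2) sqr_ge0.
  have h1 : s ^+ 2 * (2 * `|a ^+ 2 - c ^+ 2|) <= 1 * (2 * D).
    by apply: ler_pM => //; rewrite ?ler_wpM2l ?mulr_ge0.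
  have h2 : s ^+ 4 <= 1 by rewrite (exprM s 2 2) expr_le1.
  lra.
have dz : d ^+ 4 <= 1 + z.
  rewrite -zE /sym_ratio ler_pdivlMr ?exprn_gt0// (exprM d 2 2) -exprMn expr2.
  have d2 : d ^+ 2 <= 1 by rewrite expr_le1// ltW.
  have h w : d * c <= `|w| -> d ^+ 2 * D <= a ^+ 2 + w ^+ 2.
    move=> hw; have : (d * c) ^+ 2 <= w ^+ 2.
      by rewrite -(@real_normK _ w) ?num_real// lerXn2r// nnegrE mulr_ge0 ?ltW.
    have : d ^+ 2 * a ^+ 2 <= 1 * a ^+ 2 by rewrite ler_wpM2r.
    rewrite exprMn /D; lra.
  by apply: ler_pM; rewrite ?h// mulr_ge0 ?sqr_ge0// ltW.
rewrite zE (le_trans (dist_ln1D _ dz)) ?exprn_gt0//.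
have : z ^+ 2 <= 36 / D ^+ 2.
  rewrite -real_normK ?num_real// (_ : 36 / D ^+ 2 = (6 / D) ^+ 2); last first.
    by field; rewrite gt_eqF.
  by rewrite lerXn2r ?nnegrE// divr_ge0// ltW.
by move=> h; rewrite [leRHS]mulrAC ler_wpM2r// invr_ge0 exprn_ge0// ltW.
Qed.

(* At [s = 1] the product over [c] of [sym_ratio] is 1, so the subtracted term does not
   affect the columns; it cancels the terms of order [1 / (a ^+ 2 + c ^+ 2)]. *)
Definition ln_defect c a s : R := ln (sym_ratio c a s) - s ^+ 2 * ln (sym_ratio c a 1).

(** The three summands are the second-order error at [s], the same error at 1, where [d = 1 / 3] is
    admissible, and the difference of the main terms. *)
Definition defect_cst d : R := 36 / d ^+ 4 + 36 / 3^-1 ^+ 4 + 1.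

Lemma defect_cst_ge0 d : 0 < d -> 0 <= defect_cst d.
Proof.
by move=> d0; rewrite !addr_ge0// divr_ge0// exprn_ge0// ?invr_ge0// ltW.
Qed.

Lemma ln_defect_le k a s d : `|s| <= 1 -> 0 < d <= 1 ->
  (forall k, d * half_int R k <= `|half_int R k + s|) ->
  (forall k, d * half_int R k <= `|half_int R k - s|) ->
  `|ln_defect (half_int R k) a s| <=
     defect_cst d * (8 * invS2 R k) / (4^-1 + a ^+ 2).
Proof.
move=> s1 d01 ds1 ds2; have /andP[d0 _] := d01.
have k0 : 0 <= k%:R :> R by rewrite ler0n.
have c2 : 2^-1 <= half_int R k by rewrite /half_int; lra.
have h1 := dist_ln_sym_ratio a c2 s1 d01 (ds1 k) (ds2 k).
have h2 : `|ln (sym_ratio (half_int R k) a 1) -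
    (2 * (a ^+ 2 - half_int R k ^+ 2) + 1) / (a ^+ 2 + half_int R k ^+ 2) ^+ 2| <=
    36 / 3^-1 ^+ 4 / (a ^+ 2 + half_int R k ^+ 2) ^+ 2.
  have := @dist_ln_sym_ratio (half_int R k) a 1 3^-1 c2.
  rewrite normr1 lexx expr1n mul1r expr1n.
  apply => //; first by apply/andP; split; lra.
    by rewrite ger0_norm /half_int; lra.
  (* For [k = 0] the difference with 1 is negative. Equality in the bound with [1 / 3] occurs at
     [k = 1], where it reads [1 / 2 = (3 / 2) / 3]. *)
  case: k {c2 h1} k0 => [|k] k0.
    by rewrite /half_int add0r ler0_norm; lra.
  have : 0 <= k%:R :> R by rewrite ler0n.
  by rewrite /half_int -(natr1 k) => k1; rewrite ger0_norm; lra.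
have s2 : s ^+ 2 <= 1 by rewrite -real_normK ?num_real// expr_le1.
have s20 := sqr_ge0 s.
have cc : 4^-1 <= half_int R k ^+ 2 by nra.
have a20 := sqr_ge0 a.
have h3 := inv_half_int_sqr_le R k.
move: h1 h2 h3 cc (defect_cst_ge0 d0) (half_int_gt0 R k); rewrite /ln_defect /defect_cst.
move: (36 / d ^+ 4) (36 / 3^-1 ^+ 4) => C1 C2.
move: (half_int R k) (ln (sym_ratio _ a s)) (ln (sym_ratio _ a 1)) => c l1 l2 h1 h2 h3 cc C0 c0.
set D := a ^+ 2 + c ^+ 2 in h1 h2 *.
have D0 : 0 < D by rewrite /D; lra.
set z2 := (_ + 1) / D ^+ 2 in h2.
set z1 := (_ + s ^+ 4) / D ^+ 2 in h1.
(* Here the terms with [a ^+ 2 - c ^+ 2] cancel, leaving only order [1 / D ^+ 2]. *)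
have z12 : z1 - s ^+ 2 * z2 = (s ^+ 4 - s ^+ 2) / D ^+ 2 by rewrite /z1 /z2; field; rewrite gt_eqF.
have DD : 0 < (D ^+ 2)^-1 by rewrite invr_gt0 exprn_gt0.
have z12le : `|z1 - s ^+ 2 * z2| <= 1 / D ^+ 2.
  rewrite z12 normrM [X in _ * X]gtr0_norm// ler_wpM2r ?(ltW DD)//.
  rewrite (exprM s 2 2) ler_norml; apply/andP; split; nra.
have h4 : `|s ^+ 2 * (l2 - z2)| <= C2 / D ^+ 2.
  by rewrite normrM (ger0_norm s20) (le_trans _ h2)// ler_piMl.
have h5 : `|l1 - s ^+ 2 * l2| <= (C1 + C2 + 1) / D ^+ 2.
  rewrite (_ : l1 - s ^+ 2 * l2 =
    (l1 - z1) - s ^+ 2 * (l2 - z2) + (z1 - s ^+ 2 * z2)); last by ring.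
  rewrite (le_trans (ler_normD _ _))//.
  have := ler_normB (l1 - z1) (s ^+ 2 * (l2 - z2)).
  rewrite !mulrDl; lra.
(* One factor [D] is bounded below by [c ^+ 2], the other by [1 / 4 + a ^+ 2]: this separates the
   two indices of the array. *)
have h6 : (D ^+ 2)^-1 <= (c ^+ 2)^-1 / (4^-1 + a ^+ 2).
  rewrite -invfM lef_pV2 ?posrE ?exprn_gt0 ?mulr_gt0//; try lra.
  by rewrite expr2; apply: ler_pM; rewrite /D; lra.
have h7 : (c ^+ 2)^-1 <= 8 * invS2 R k by move: h3; rewrite invfM ler_pdivrMl.
have h8 : 0 <= (4^-1 + a ^+ 2)^-1 by rewrite invr_ge0; lra.
apply: (le_trans h5); rewrite -[leRHS]mulrA; apply: ler_wpM2l => //.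
by apply: (le_trans h6); exact: ler_wpM2r.
Qed.

End Interchange.

(** * Row and column products of the array, and the exchange of summations *)

Section DefectSums.
Variable R : realType.
Implicit Types a c s u lam : R.

Definition ch2 a : R := expR (2 * pi * a) + expR (- (2 * pi * a)).

Lemma ch2_gt2 a : a != 0 -> 2 < ch2 a.
Proof.
move=> a0; have v0 : 2 * pi * a != 0 by rewrite !mulf_neq0// gt_eqF ?pi_gt0.
have := expR_gt1Dx v0; have := expR_gt1Dx (_ : - (2 * pi * a) != 0).
by rewrite oppr_eq0 => /(_ v0); rewrite /ch2; lra.
Qed.

Lemma ch2_ge2 a : 2 <= ch2 a.
Proof.
have [->|/ch2_gt2/ltW//] := eqVneq a 0.
by rewrite /ch2 mulr0 oppr0 expR0; lra.
Qed.

Lemma half_int_neq0 k (s : R) : `|s| < 2^-1 \/ s = 1 ->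
  half_int R k + s != 0 /\ half_int R k - s != 0.
Proof.
have k0 : 0 <= k%:R :> R by rewrite ler0n.
case=> [|->].
  by rewrite ltr_norml /half_int => /andP[s1 s2]; split; rewrite gt_eqF//; lra.
split; first by rewrite /half_int gt_eqF//; lra.
case: k {k0} => [|k]; first by rewrite /half_int add0r lt_eqF//; lra.
have k0 : 0 <= k%:R :> R by rewrite ler0n.
by rewrite /half_int -(natr1 k) gt_eqF//; lra.
Qed.

Lemma cvg_ln_sum (f : R^nat) (l : R) : (forall n, 0 < f n) -> 0 < l ->
  (fun n => \prod_(0 <= i < n) f i) @ \oo --> l ->
  (fun n => \sum_(0 <= i < n) ln (f i)) @ \oo --> ln l.
Proof.
move=> f0 l0 fl; under eq_fun do rewrite -ln_prod//.
by apply: continuous_cvg => //; exact: continuous_ln.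
Qed.

Lemma cvgB_scale (f g : R^nat) (l m v : R) :
  f @ \oo --> l -> g @ \oo --> m -> (fun n => f n - v * g n) @ \oo --> l - v * m.
Proof. by move=> fl gm; apply: cvgB => //; apply: cvgM => //; exact: cvg_cst. Qed.

(** With [w = e^(-2 pi a)] this is [(1 + 2 w cos (2 pi s) + w^2) / (1 + w)^2], the form of a factor
    in Jacobi's product for [theta_2 (pi s) / theta_2 (0)]. *)
Definition theta_ratio a s : R := (ch2 a + 2 * cos (2 * pi * s)) / (ch2 a + 2).

Lemma col_prod a s : (fun K => \prod_(0 <= k < K) sym_ratio (half_int R k) a s) @ \oo -->
  theta_ratio a s.
Proof.
have h1 := @coshcos_prod R a s; have := @coshcos_prod R a 0.
rewrite mulr0 cos0 mulr1 -/(ch2 a) => h0.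
have c2 := ch2_ge2 a.
have nz : (ch2 a + 2) / 4 != 0 by rewrite gt_eqF// divr_gt0//; lra.
have /(_ _) := cvg_quot nz h1 h0; rewrite (_ : _ / _ / (_ / _) = theta_ratio a s); last first.
  by rewrite /theta_ratio -/(ch2 a); field; rewrite gt_eqF//; lra.
apply: cvg_trans; apply: near_eq_cvg; apply: nearW => K /=.
rewrite -prodf_div; apply: eq_bigr => k _.
have h := half_int_gt0 R k; have := sqr_ge0 a; rewrite addr0 subr0 /sym_ratio => a2.
by field; rewrite !gt_eqF//= ltr_wpDl// exprn_gt0.
Qed.

(** This is [4 sinh^2 (pi u / lam)]. *)
Definition sinh2 lam u : R := ch2 (u / lam) - 2.

Definition sinh2_ratio lam c s : R :=
  sinh2 lam (c + s) * sinh2 lam (c - s) / sinh2 lam c ^+ 2.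

Lemma sinh2_gt0 lam u : 0 < lam -> u != 0 -> 0 < sinh2 lam u.
Proof.
move=> l0 u0; rewrite subr_gt0 ch2_gt2// mulf_neq0// invr_neq0// gt_eqF//.
Qed.

(** The roles are exchanged: [coshcos_prod] is used with [u / lam] as its [a] and with shift
    [1 / 2], so that [half_int m] plus or minus the shift is [m + 1] or [m]. The normalising powers
    of [half_int m] cancel in the quotient of the products at [c + s], [c - s] and twice [c]. *)
Lemma row_prod lam c s : 0 < lam -> 0 < c -> c + s != 0 -> c - s != 0 ->
  (fun M => \prod_(0 <= m < M) (sym_ratio c (lam * m%:R) s * sym_ratio c (lam * m.+1%:R) s))
    @ \oo --> sinh2_ratio lam c s.
Proof.
move=> l0 c0 cs1 cs2.
pose P u M := \prod_(0 <= m < M)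
  (((u / lam) ^+ 2 + m.+1%:R ^+ 2) * ((u / lam) ^+ 2 + m%:R ^+ 2) / half_int R m ^+ 4).
have cvgP u : P u @ \oo --> sinh2 lam u / 4.
  have := @coshcos_prod R (u / lam) 2^-1.
  rewrite (_ : 2 * pi * 2^-1 = pi); last by field.
  rewrite cospi mulrN1 -/(ch2 _) -/(sinh2 _ _).
  apply: cvg_trans; apply: near_eq_cvg; apply: nearW => K /=.
  apply: eq_bigr => k _; congr (_ * _ / _).
    by rewrite /half_int -natr1; congr (_ + _ ^+ 2); field.
  by rewrite /half_int addrK.
have h0 := sinh2_gt0 l0 (lt0r_neq0 c0).
have nz : sinh2 lam c / 4 * (sinh2 lam c / 4) != 0 by rewrite gt_eqF// mulr_gt0// divr_gt0.
have : (fun M => (P (c + s) M * P (c - s) M) / (P c M * P c M)) @ \oo -->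
    sinh2_ratio lam c s.
  rewrite (_ : sinh2_ratio lam c s = (sinh2 lam (c + s) / 4 * (sinh2 lam (c - s) / 4)) /
    (sinh2 lam c / 4 * (sinh2 lam c / 4))); last first.
    by rewrite /sinh2_ratio; field; rewrite gt_eqF.
  by apply: cvg_quot => //; apply: cvgM.
apply: cvg_trans; apply: near_eq_cvg; apply: nearW => M /=.
rewrite -!big_split/= -prodf_div; apply: eq_bigr => m _.
have h := half_int_gt0 R m; rewrite /sym_ratio.
have e v : (v / lam) ^+ 2 + m%:R ^+ 2 = ((lam * m%:R) ^+ 2 + v ^+ 2) / lam ^+ 2.
  by field; rewrite gt_eqF.
have e' v : (v / lam) ^+ 2 + m.+1%:R ^+ 2 = ((lam * m.+1%:R) ^+ 2 + v ^+ 2) / lam ^+ 2.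
  by field; rewrite gt_eqF.
rewrite !e !e'.
have p x : (lam * x) ^+ 2 + c ^+ 2 != 0.
  by rewrite gt_eqF// ltr_wpDl ?sqr_ge0// exprn_gt0.
have := p m%:R; have := p m.+1%:R.
move: ((lam * m%:R) ^+ 2) ((lam * m.+1%:R) ^+ 2) => x y y0 x0.
by field; rewrite x0 y0 !gt_eqF.
Qed.

(* Since m and -m contribute equally, the pairs m, m + 1 with m >= 0 account for every
   integer exactly once; [coshcos_prod] at [s = 2^-1] delivers the rows in this form. *)
Lemma double_defect_sum lam s (X : R) : 0 < lam -> `|s| < 2^-1 ->
  (fun K => \sum_(0 <= k < K) (ln (sinh2_ratio lam (half_int R k) s) -
     s ^+ 2 * ln (sinh2_ratio lam (half_int R k) 1))) @ \oo --> X ->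
  (fun M => \sum_(0 <= m < M) (ln (theta_ratio (lam * m%:R) s) +
     ln (theta_ratio (lam * m.+1%:R) s))) @ \oo --> X.
Proof.
move=> l0 s2 hX.
have s1 : `|s| <= 1 by lra.
pose B k m := ln_defect (half_int R k) (lam * m%:R) s + ln_defect (half_int R k) (lam * m.+1%:R) s.
have srp k a v : `|v| < 2^-1 \/ v = 1 -> 0 < sym_ratio (half_int R k) a v.
  by move=> /(half_int_neq0 k)[? ?]; apply: sym_ratio_gt0 => //; exact: half_int_gt0.
(* Since every half-integer [c] in play is at least [1 / 2], one has
   [c - |s| >= (1 - 2 * |s|) * c]. *)
pose d := 1 - 2 * `|s|.
have s0 := normr_ge0 s.
have d01 : 0 < d <= 1 by apply/andP; rewrite /d; split; lra.
have hd k (v : R) : `|v| = `|s| -> d * half_int R k <= `|half_int R k + v|.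
  move=> vs; have k0 : 0 <= k%:R :> R by rewrite ler0n.
  have h : 2^-1 <= half_int R k by rewrite /half_int; lra.
  have := ler_normB (half_int R k + v) v; rewrite addrK vs ger0_norm ?(ltW (half_int_gt0 _ _))//.
  by rewrite /d; nra.
(* The last factor is made for [(m + 1) * (m + 2) <= 4 * m ^+ 2 + 2]: its first term times
   [(lam * x) ^+ 2] gives [4 * x ^+ 2], its second times [1 / 4] gives 2. *)
pose C := defect_cst d * 8 * (4 / lam ^+ 2 + 8).
have C0 : 0 <= defect_cst d by apply: defect_cst_ge0; case/andP: d01.
have half_bnd k m x : m%:R <= x ->
    `|ln_defect (half_int R k) (lam * x) s| <= C * invS2 R k * invS2 R m.
  move=> mx.
  have := @ln_defect_le R k (lam * x) s d s1 d01 (fun k => hd k s erefl).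
  move=> /(_ _)/le_trans; apply; first by move=> j; rewrite hd// normrN.
  rewrite /C -!mulrA ler_wpM2l// ler_wpM2l// [leRHS]mulrCA ler_wpM2l ?(ltW (invS2_gt0 _ _))//.
  have m0 : 0 <= m%:R :> R by rewrite ler0n.
  have x0 : 0 <= (lam * x) ^+ 2 by exact: sqr_ge0.
  rewrite /invS2 -(natr1 m.+1) -(natr1 m).
  have p1 : 0 < 4^-1 + (lam * x) ^+ 2 by lra.
  have p2 : 0 < (m%:R + 1) * (m%:R + 1 + 1) :> R by rewrite mulr_gt0//; lra.
  rewrite ler_pdivlMr// ler_pdivrMl//.
  have q1 : 4 / lam ^+ 2 * (lam * x) ^+ 2 = 4 * x ^+ 2 by field; rewrite gt_eqF.
  have q2 : 0 <= 4 / lam ^+ 2 by rewrite divr_ge0// sqr_ge0.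
  have q3 : m%:R ^+ 2 <= x ^+ 2 by rewrite lerXn2r// nnegrE (le_trans m0).
  nra.
apply: (@double_sum_cvg R B _ _ (C + C)) hX.
- move=> k m; rewrite (le_trans (ler_normD _ _))// !mulrDl lerD//.
    exact: half_bnd.
  by apply: half_bnd; rewrite ler_nat.
- move=> k.
  have rowln v : `|v| < 2^-1 \/ v = 1 ->
    (fun M => \sum_(0 <= m < M) ln (sym_ratio (half_int R k) (lam * m%:R) v *
      sym_ratio (half_int R k) (lam * m.+1%:R) v)) @ \oo --> ln (sinh2_ratio lam (half_int R k) v).
    move=> hv; have [v1 v2] := half_int_neq0 k hv; have c0 := half_int_gt0 R k.
    apply: cvg_ln_sum.
    - by move=> m; rewrite mulr_gt0// srp.
    - rewrite divr_gt0 ?mulr_gt0 ?exprn_gt0 ?sinh2_gt0//; exact: lt0r_neq0.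
    exact: row_prod.
  have := @cvgB_scale _ _ _ _ (s ^+ 2) (rowln s (or_introl s2)) (rowln 1 (or_intror erefl)).
  apply: cvg_trans; apply: near_eq_cvg; apply: nearW => M /=.
  rewrite mulr_sumr -sumrB; apply: eq_bigr => m _.
  have lnE v : `|v| < 2^-1 \/ v = 1 -> ln (sym_ratio (half_int R k) (lam * m%:R) v *
      sym_ratio (half_int R k) (lam * m.+1%:R) v) =
      ln (sym_ratio (half_int R k) (lam * m%:R) v) +
      ln (sym_ratio (half_int R k) (lam * m.+1%:R) v).
    by move=> hv; apply: lnM; rewrite posrE srp.
  by rewrite !lnE; [rewrite /B /ln_defect; ring|right|left].
move=> m.
have trp a : 0 < theta_ratio a s.
  have := ch2_ge2 a => c2; rewrite divr_gt0//; last lra.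
  have : -1 < cos (2 * pi * s).
    rewrite (_ : 2 * pi * s = (pi * s) *+ 2); last by rewrite -[RHS]mulr_natr; ring.
    rewrite cos_mulr2n ltrBDl subrr pmulrn_lgt0// exprn_even_gt0//= gt_eqF//.
    move: s2; rewrite ltr_norml => /andP[sl sr]; have := pi_gt0 R => pi0.
    by apply: cos_gt0_pihalf; apply/andP; split; nra.
  by move=> ?; lra.
have colln a : (fun K => \sum_(0 <= k < K) ln_defect (half_int R k) a s) @ \oo -->
    ln (theta_ratio a s).
  have t1 : theta_ratio a 1 = 1.
    rewrite /theta_ratio mulr1 (_ : 2 * pi = pi *+ 2); last by rewrite mulr_natl.
    by rewrite cos2pi mulr1 divff// gt_eqF//; have := ch2_ge2 a; lra.
  have h1 : (fun K => \sum_(0 <= k < K) ln (sym_ratio (half_int R k) a s)) @ \oo -->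
      ln (theta_ratio a s).
    by apply: cvg_ln_sum (@col_prod a s) => // k; apply: srp; left.
  have h2 : (fun K => \sum_(0 <= k < K) ln (sym_ratio (half_int R k) a 1)) @ \oo -->
      ln (theta_ratio a 1).
    apply: cvg_ln_sum (@col_prod a 1) => [k|]; first by apply: srp; right.
    by rewrite t1.
  have := @cvgB_scale _ _ _ _ (s ^+ 2) h1 h2; rewrite t1 ln1 mulr0 subr0.
  apply: cvg_trans; apply: near_eq_cvg; apply: nearW => K /=.
  by rewrite mulr_sumr -sumrB.
under eq_fun do rewrite big_split.
by apply: cvgD; exact: colln.
Qed.

End DefectSums.

(** * q-Pochhammer symbols *)

Section QPochhammer.
Variable R : realType.
Implicit Types a x y : R.

(** Weierstrass's product inequality. *)
Lemma prod_1B_bounds (u : R^nat) n : (forall k, 0 <= u k <= 1) ->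
  1 - \sum_(0 <= k < n) u k <= \prod_(0 <= k < n) (1 - u k) <= 1.
Proof.
move=> u01; elim: n => [|n IH]; first by rewrite !big_geq// subr0 lexx.
have pos : 0 <= \prod_(0 <= k < n) (1 - u k).
  by apply: prodr_ge0 => k _; rewrite subr_ge0; have /andP[] := u01 k.
rewrite !big_nat_recr//=; have /andP[u0 u1] := u01 n; case/andP: IH => h1 h2.
by apply/andP; split; nra.
Qed.

Variable q : R.
Hypotheses (q0 : 0 < q) (q1 : q < 1).

Lemma sum_expr_le n : \sum_(0 <= k < n) q ^+ k <= (1 - q)^-1.
Proof.
have p : 0 < 1 - q by rewrite subr_gt0.
rewrite -[leRHS]mul1r ler_pdivlMr//.
have -> : (\sum_(0 <= k < n) q ^+ k) * (1 - q) = 1 - q ^+ n.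
  elim: n => [|n IH]; first by rewrite big_geq// mul0r expr0 subrr.
  by rewrite big_nat_recr//= mulrDl IH exprS; ring.
by rewrite lerBlDr lerDl exprn_ge0// ltW.
Qed.

Lemma cvg_expq : (fun n => q ^+ n) @ \oo --> (0 : R).
Proof. by apply: cvg_expr; rewrite ger0_norm// ltW. Qed.

(** For such [a] the terms [a * q ^+ k] sum to at most [1 / 2], so the decreasing partial products
    stay above [1 / 2]. *)
Lemma qpoch_small a : 0 <= a -> a <= (1 - q) / 2 -> exists2 l : R, 2^-1 <= l &
  (fun n => \prod_(0 <= k < n) (1 - a * q ^+ k)) @ \oo --> l.
Proof.
move=> a0 aq.
have u01 k : 0 <= a * q ^+ k <= 1.
  rewrite mulr_ge0 ?exprn_ge0 ?(ltW q0)//=.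
  have : q ^+ k <= 1 by rewrite exprn_ile1// ltW.
  by move=> /(ler_wpM2l a0); rewrite mulr1; move: q0 q1; lra.
have lb n : 2^-1 <= \prod_(0 <= k < n) (1 - a * q ^+ k).
  have /andP[h _] := prod_1B_bounds n u01; rewrite (le_trans _ h)//.
  have : a * \sum_(0 <= k < n) q ^+ k <= 2^-1.
    rewrite (@le_trans _ _ ((1 - q) / 2 * (1 - q)^-1))//.
      by apply: ler_pM => //; [apply: sumr_ge0 => k _; rewrite exprn_ge0// ltW|exact: sum_expr_le].
    by rewrite mulrAC divff ?mul1r//; apply: lt0r_neq0; move: q0 q1; lra.
  by rewrite mulr_sumr; move: q0 q1; lra.
have nd : nonincreasing_seq (fun n => \prod_(0 <= k < n) (1 - a * q ^+ k)).
  apply/nonincreasing_seqP => n; rewrite big_nat_recr//=.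
  have := lb n; have /andP[] := u01 n; nra.
have cv : cvgn (fun n => \prod_(0 <= k < n) (1 - a * q ^+ k)).
  apply: nonincreasing_is_cvgn => //.
  by exists 2^-1 => _ [n _ <-].
exists (limn (fun n => \prod_(0 <= k < n) (1 - a * q ^+ k))); last exact: cv.
by apply: limr_ge => //; near=> n; exact: lb.
Unshelve. all: by end_near.
Qed.

(** Splitting off the first [N] factors replaces [a] by [a * q ^+ N], which is eventually small
    enough for [qpoch_small]; the limit can then vanish only through one of the finitely many
    factors split off. *)
Lemma cvg_qpochhammer_ex a : 0 <= a -> exists l : R,
  (fun n => \prod_(0 <= k < n) (1 - a * q ^+ k)) @ \oo --> l /\
  ((forall k, 1 - a * q ^+ k != 0) -> l != 0).
Proof.
move=> a0.
have : \forall n \near \oo, a * q ^+ n <= (1 - q) / 2.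
  have : (fun n => a * q ^+ n) @ \oo --> (0 : R).
    by rewrite -(mulr0 a); apply: cvgM; [exact: cvg_cst|exact: cvg_expq].
  by move=> /cvgr_le; apply; rewrite divr_gt0// subr_gt0.
move=> [N _ /(_ N (leqnn N)) aN].
have [|l l2 hl] := qpoch_small _ aN; first by rewrite mulr_ge0// exprn_ge0// ltW.
exists (\prod_(0 <= k < N) (1 - a * q ^+ k) * l); split.
  rewrite -(cvg_shiftn N) /=.
  rewrite (_ : (fun n => _) = fun n => \prod_(0 <= k < N) (1 - a * q ^+ k) *
      \prod_(0 <= k < n) (1 - (a * q ^+ N) * q ^+ k)); last first.
    apply/funext => n; rewrite (big_cat_nat (leq0n N) (leq_addl n N))/=; congr (_ * _).
    rewrite (big_addn 0 _ N) addnK; apply: eq_bigr => k _.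
    by rewrite exprD mulrAC mulrA.
  by apply: cvgM => //; exact: cvg_cst.
move=> an; rewrite mulf_neq0//; last by apply: lt0r_neq0; move: q0 q1; lra.
by rewrite prodf_seq_neq0; apply/allP => k _; apply/implyP.
Qed.

Lemma cvg_qpochhammer a : 0 <= a ->
  (fun n => \prod_(0 <= k < n) (1 - a * q ^+ k)) @ \oo --> qpochhammer a q.
Proof.
move=> /cvg_qpochhammer_ex[l [hl _]].
by rewrite /qpochhammer /infprod (cvg_lim _ hl).
Qed.

Lemma qpochhammer_neq0 a : 0 <= a -> (forall k, 1 - a * q ^+ k != 0) ->
  qpochhammer a q != 0.
Proof.
by move=> /cvg_qpochhammer_ex[l [hl l0]] /l0; rewrite /qpochhammer /infprod (cvg_lim _ hl).
Qed.

Lemma qpochhammer_shift a : 0 <= a -> qpochhammer a q = (1 - a) * qpochhammer (a * q) q.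
Proof.
move=> a0.
suff h : (fun n => \prod_(0 <= k < n) (1 - a * q ^+ k)) @ \oo -->
    (1 - a) * qpochhammer (a * q) q.
  by rewrite [LHS]/qpochhammer /infprod (cvg_lim _ h).
rewrite -(cvg_shiftn 1) /=.
rewrite (_ : (fun n => _) = fun n => (1 - a) *
    \prod_(0 <= k < n) (1 - (a * q) * q ^+ k)); last first.
  apply/funext => n; rewrite addn1 big_nat_recl// expr0 mulr1; congr (_ * _).
  by apply: eq_bigr => k _; rewrite exprS mulrA.
apply: cvgM; first exact: cvg_cst.
by apply: cvg_qpochhammer; rewrite mulr_ge0// ltW.
Qed.

Lemma powR_neq1 x : x != 0 -> q `^ x != 1.
Proof. by move=> x0; rewrite powR_eq1 !negb_or x0 lt_eqF// ltNge ltW. Qed.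

Lemma qpow_factor_neq0 x k : x + k%:R != 0 -> 1 - q `^ x * q ^+ k != 0.
Proof.
move=> xk; rewrite -powR_mulrn ?ltW// -powRD; last by rewrite (negbTE xk).
by rewrite subr_eq0 eq_sym powR_neq1.
Qed.

Definition qpoch_pow x : R := qpochhammer (q `^ x) q.

Lemma cvg_qpoch_pow x : (fun n => \prod_(0 <= k < n) (1 - q `^ (k%:R + x))) @ \oo --> qpoch_pow x.
Proof.
have := cvg_qpochhammer (powR_ge0 q x); apply: cvg_trans.
apply: near_eq_cvg; apply: nearW => n; apply: eq_bigr => k _.
rewrite -powR_mulrn ?ltW// -powRD ?(gt_eqF q0) ?implybT//.
by congr (1 - q `^ _); rewrite addrC.
Qed.

Lemma qpoch_pow_neq0 x : (forall k, x + k%:R != 0) -> qpoch_pow x != 0.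
Proof.
by move=> xk; apply: qpochhammer_neq0; [rewrite powR_ge0|move=> k; exact: qpow_factor_neq0].
Qed.

Lemma qpoch_pow_shift x : qpoch_pow x = (1 - q `^ x) * qpoch_pow (x + 1).
Proof.
rewrite /qpoch_pow qpochhammer_shift ?powR_ge0//; congr (_ * qpochhammer _ _).
by rewrite powRD ?powRr1 ?ltW// (gt_eqF q0) implybT.
Qed.

Lemma nint_addn_neq0 x k : x \isn't a Num.int -> x + k%:R != 0.
Proof.
by apply: contraNneq => /eqP; rewrite addr_eq0 => /eqP ->; rewrite rpredN rpred_nat.
Qed.

Lemma nint_1B x : x \isn't a Num.int -> 1 - x \isn't a Num.int.
Proof.
apply: contra => h; rewrite (_ : x = 1 - (1 - x)); last by ring.
by rewrite rpredB ?rpred1.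
Qed.

(** The common form of [reflection_gamma] and [reflection_prod] off the integers. *)
Definition reflection x : R := sin (pi * x) * q `^ (- (x * (x - 1) / 2)) * ln q^-1 *
  (qpoch_pow 1 ^+ 2 / (qpoch_pow x * qpoch_pow (1 - x))).

Lemma reflection_prodE x : x \isn't a Num.int -> reflection_prod q x = reflection x.
Proof.
move=> xn; rewrite /reflection_prod /reflection; congr (_ * _); apply: cvg_lim => //.
have xn' : 1 - x \isn't a Num.int by exact: nint_1B.
rewrite (_ : (fun n => _) = fun n =>
   (\prod_(0 <= k < n) (1 - q `^ (k%:R + 1)) * \prod_(0 <= k < n) (1 - q `^ (k%:R + 1))) /
   (\prod_(0 <= k < n) (1 - q `^ (k%:R + x)) * \prod_(0 <= k < n) (1 - q `^ (k%:R + (1 - x))))).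
  rewrite expr2; apply: cvg_quot; last 2 first.
  - by apply: cvgM; exact: cvg_qpoch_pow.
  - by apply: cvgM; exact: cvg_qpoch_pow.
  by rewrite mulf_neq0// qpoch_pow_neq0// => k; exact: nint_addn_neq0.
apply/funext => n; rewrite -!big_split/= -prodf_div; apply: eq_bigr => k _.
by rewrite [k%:R + (1 - x)]addrA natr1 expr2.
Qed.

Lemma reflection_gammaE x : x \isn't a Num.int -> reflection_gamma q x = reflection x.
Proof.
move=> xn; rewrite /reflection_gamma /reflection /qgamma.
have xn' : 1 - x \isn't a Num.int by exact: nint_1B.
have qx : qpoch_pow x != 0 by apply: qpoch_pow_neq0 => k; exact: nint_addn_neq0.
have qx' : qpoch_pow (1 - x) != 0 by apply: qpoch_pow_neq0 => k; exact: nint_addn_neq0.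
rewrite -/(qpoch_pow x) -/(qpoch_pow (1 - x)) [qpoch_pow 1]/qpoch_pow powRr1 ?ltW//.
have p : 0 < 1 - q by rewrite subr_gt0.
(* The powers of [1 - q] in the two q-gamma factors combine to cancel the denominator. *)
have e : (1 - q) `^ (1 - x) * (1 - q) `^ (1 - (1 - x)) = 1 - q.
  rewrite -powRD; last by rewrite (gt_eqF p) implybT.
  by rewrite (_ : 1 - x + _ = 1) ?powRr1 ?ltW//; ring.
move: (qpoch_pow x) (qpoch_pow (1 - x)) (qpochhammer q q) qx qx' e (lt0r_neq0 p).
move: (sin _ * _) (1 - q) (ln q^-1) => S w l; move: (w `^ _) (w `^ _) => A B u v z u0 v0 <-.
rewrite mulf_eq0 negb_or => /andP[A0 B0].
by field; rewrite A0 B0 u0 v0.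
Qed.

(** The sine changes sign, the power of [q] gains [q^(-x)], and the Pochhammer quotient gains
    [(1 - q^x) / (1 - q^(-x)) = - q^x]. *)
Lemma reflectionD1 x : x \isn't a Num.int -> reflection (x + 1) = reflection x.
Proof.
move=> xn; rewrite /reflection.
have xn' : 1 - x \isn't a Num.int by exact: nint_1B.
have qx : qpoch_pow (x + 1) != 0.
  by apply: qpoch_pow_neq0 => k; rewrite -addrA nat1r; exact: nint_addn_neq0.
have qx' : qpoch_pow (1 - x) != 0 by apply: qpoch_pow_neq0 => k; exact: nint_addn_neq0.
rewrite mulrDr mulr1 sinDpi.
rewrite (_ : 1 - (x + 1) = - x); last by ring.
rewrite (qpoch_pow_shift (- x)) (qpoch_pow_shift x) (addrC (- x)).
have x0 : x != 0 by apply: contraNneq xn => ->; rewrite rpred0.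
rewrite (_ : - ((x + 1) * (x + 1 - 1) / 2) = - (x * (x - 1) / 2) + - x); last by field.
rewrite powRD; last by rewrite (gt_eqF q0) implybT.
have := powR_neq1 x0; have := powR_gt0 x q0; rewrite (powRN _ x).
move: qx qx'; move: (qpoch_pow (x + 1)) (qpoch_pow (1 - x)) (q `^ _)
  (sin _) (ln _) (qpoch_pow 1) (q `^ x).
move=> u v B C D E y u0 v0 y0 y1.
have yn0 : y != 0 by exact: lt0r_neq0.
have y1' : 1 - y != 0 by rewrite subr_eq0 eq_sym.
by field; rewrite v0 u0 y1' yn0 subr_eq0.
Qed.

Lemma int_numDz x (n : int) : (x + n%:~R \is a Num.int) = (x \is a Num.int).
Proof. by rewrite rpredDr// intr_int. Qed.

Lemma reflectionDz x (n : int) : x \isn't a Num.int -> reflection (x + n%:~R) = reflection x.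
Proof.
have nat_shift (m : nat) y : y \isn't a Num.int -> reflection (y + m%:R) = reflection y.
  move=> yn; elim: m => [|m IH]; first by rewrite addr0.
  by rewrite -natr1 addrA reflectionD1// (pmulrn _ m) int_numDz.
move=> xn; case: n => m; first exact: nat_shift.
rewrite NegzE -[in RHS](subrK m.+1%:R x) nat_shift ?mulrNz//.
by rewrite (pmulrn _ m.+1) -mulrNz int_numDz.
Qed.

Lemma cvg_powR0 x : q `^ (y * x) @[y --> (0 : R)] --> (1 : R).
Proof.
rewrite /powR; under eq_fun do rewrite (gt_eqF q0).
have : y * x * ln q @[y --> (0 : R)] --> 0 * x * ln q.
  by apply: cvgM; [apply: cvgM => //|]; exact: cvg_cst.
rewrite !mul0r -expR0 => h.
by apply: continuous_cvg h; exact: continuous_expR.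
Qed.

(** With [X = q ^+ k.+1] and [z = q^y], one has [(1 - X z) (1 - X / z) = (1 - X)^2 - X d]. The
    quotient is thus a product of factors [1 - u k] with [u] of sum at most [d / (1 - q) ^+ 3], and
    [prod_1B_bounds] applies. *)
Lemma qpoch_pow_pair_bounds y (d := q `^ y + q `^ (- y) - 2) : d / (1 - q) ^+ 3 <= 1 ->
  1 - d / (1 - q) ^+ 3 <= qpoch_pow (1 + y) * qpoch_pow (1 - y) / qpoch_pow 1 ^+ 2 <= 1.
Proof.
move=> dle.
have p : 0 < 1 - q by rewrite subr_gt0.
have z0 := powR_gt0 y q0; have zz : q `^ y * q `^ (- y) = 1.
  by rewrite powRN divff// gt_eqF.
have d0 : 0 <= d.
  have : 0 <= (q `^ y - 1) ^+ 2 * q `^ (- y) by rewrite mulr_ge0 ?sqr_ge0 ?powR_ge0.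
  by rewrite /d; nra.
have X01 k : 0 < q ^+ k.+1 <= q.
  by rewrite exprn_gt0//= exprS ger_pMr// exprn_ile1// ltW.
pose u k := q ^+ k.+1 * d / (1 - q ^+ k.+1) ^+ 2.
have u_le k : 0 <= u k <= q ^+ k * (d / (1 - q) ^+ 2).
  have /andP[h1 h2] := X01 k.
  have h3 : 0 < 1 - q ^+ k.+1 by rewrite subr_gt0 (le_lt_trans h2).
  have h4 : 0 <= d / (1 - q ^+ k.+1) ^+ 2 by rewrite divr_ge0// exprn_ge0// ltW.
  rewrite /u -mulrA mulr_ge0 ?(ltW h1)//=.
  apply: ler_pM => //; first exact: ltW.
    by rewrite exprS ler_piMl ?exprn_ge0// ltW.
  rewrite ler_wpM2l// lef_pV2 ?posrE ?exprn_gt0//.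
  by rewrite lerXn2r ?nnegrE ?(ltW p) ?(ltW h3)// lerD2l lerN2.
have sum_u n : \sum_(0 <= k < n) u k <= d / (1 - q) ^+ 3.
  apply: (@le_trans _ _ (\sum_(0 <= k < n) q ^+ k * (d / (1 - q) ^+ 2))).
    by apply: ler_sum => k _; have /andP[] := u_le k.
  rewrite -mulr_suml (@le_trans _ _ ((1 - q)^-1 * (d / (1 - q) ^+ 2)))//.
    by rewrite ler_wpM2r ?sum_expr_le// divr_ge0// sqr_ge0.
  by rewrite le_eqVlt; apply/orP; left; apply/eqP; field; rewrite gt_eqF.
have u01 k : 0 <= u k <= 1.
  have /andP[h1 _] := u_le k; rewrite h1/= (le_trans _ dle)// (le_trans _ (sum_u k.+1))//.
  rewrite big_nat_recr//= lerDr sumr_ge0// => i _; by have /andP[] := u_le i.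
have qpo1 : qpoch_pow 1 != 0.
  by apply: qpoch_pow_neq0 => k; rewrite nat1r pnatr_eq0.
have h : (fun n => \prod_(0 <= k < n) (1 - u k)) @ \oo -->
    qpoch_pow (1 + y) * qpoch_pow (1 - y) / qpoch_pow 1 ^+ 2.
  rewrite (_ : (fun n => _) = fun n =>
    (\prod_(0 <= k < n) (1 - q `^ (k%:R + (1 + y))) *
     \prod_(0 <= k < n) (1 - q `^ (k%:R + (1 - y)))) /
    (\prod_(0 <= k < n) (1 - q `^ (k%:R + 1)) * \prod_(0 <= k < n) (1 - q `^ (k%:R + 1)))).
    rewrite expr2; apply: cvg_quot; first by rewrite mulf_neq0.
      by apply: cvgM; exact: cvg_qpoch_pow.
    by apply: cvgM; exact: cvg_qpoch_pow.
  apply/funext => n; rewrite -!big_split/= -prodf_div; apply: eq_bigr => k _.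
  rewrite !addrA natr1.
  have /andP[h1 h2] := X01 k.
  have h3 : 1 - q ^+ k.+1 != 0 by rewrite gt_eqF// subr_gt0 (le_lt_trans h2).
  have e v : q `^ (k.+1%:R + v) = q ^+ k.+1 * q `^ v.
    by rewrite powRD ?powR_mulrn ?(ltW q0)// (gt_eqF q0) implybT.
  rewrite !e powR_mulrn ?(ltW q0)// /u /d.
  move: zz h3; move: (q `^ y) (q `^ (- y)) (q ^+ k.+1) => z z' X zz h3.
  have -> : (1 - X * z) * (1 - X * z') = (1 - X) ^+ 2 - X * (z + z' - 2) by ring: zz.
  by field.
apply/andP; split.
  apply: (cvgr_to_ge h); apply: nearW => n.
  have /andP[h1 _] := prod_1B_bounds n u01; rewrite (le_trans _ h1)//.
  by rewrite lerB.
by apply: (cvgr_to_le h); apply: nearW => n; have /andP[] := prod_1B_bounds n u01.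
Qed.

Lemma cvg_qpoch_pow_pair :
  qpoch_pow (1 + y) * qpoch_pow (1 - y) / qpoch_pow 1 ^+ 2 @[y --> (0 : R)] --> (1 : R).
Proof.
have d0 : (q `^ y + q `^ (- y) - 2) / (1 - q) ^+ 3 @[y --> (0 : R)] --> (0 : R).
  have : (q `^ y + q `^ (- y) - 2) / (1 - q) ^+ 3 @[y --> (0 : R)] -->
      (1 + 1 - 2) / (1 - q) ^+ 3.
    apply: cvgM; last exact: cvg_cst.
    apply: cvgB; last exact: cvg_cst.
    apply: cvgD.
      by have := @cvg_powR0 1; under eq_fun do rewrite mulr1.
    by have := @cvg_powR0 (-1); under eq_fun do rewrite mulrN1.
  by rewrite (_ : 1 + 1 - 2 = 0) ?mul0r//; ring.
apply: (squeeze_cvgr (f := fun y => 1 - (q `^ y + q `^ (- y) - 2) / (1 - q) ^+ 3) (h := cst 1)).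
- near=> y; apply: qpoch_pow_pair_bounds.
  near: y; move/cvgr_le : d0; apply; exact: ltr01.
- by rewrite -[X in _ --> X]subr0; apply: cvgB => //; exact: cvg_cst.
- exact: cvg_cst.
Unshelve. all: by end_near.
Qed.

Lemma lnq_lt0 : ln q < 0.
Proof. by rewrite ln_lt0// q0. Qed.

Lemma cvg_dnbhs_of (f : R -> R) (x l : R) : f y @[y --> x] --> l -> f y @[y --> x^'] --> l.
Proof. by move=> fl; exact: (cvg_trans (cvg_app f (@nbhs_dnbhs _ x))). Qed.

Lemma cvg_1B_powR : y^-1 * (1 - q `^ y) @[y --> (0 : R)^'] --> - ln q.
Proof.
apply: (@cvg_diff_quotient _ (fun y => 1 - q `^ y)); first by rewrite powRr0 subrr.
have h := @is_derive1_comp _ _ ( *%R^~ (ln q)) 0 _ _ (is_derive_expR (0 * ln q))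
  (is_derive_mulr_const 0 (ln q)).
rewrite mul0r expR0 mul1r in h.
rewrite (_ : (fun y => _) = cst 1 - (expR \o *%R^~ (ln q))); last first.
  by apply/funext => y; rewrite /powR (gt_eqF q0).
apply: is_derive_eq (is_deriveB (is_derive_cst _ _ _) h) _.
by rewrite sub0r.
Qed.

(** Splitting [1 - q^y] off [qpoch_pow y] exposes the pole; it behaves like [- y * ln q], the sine
    like [pi * y], and the logarithms cancel. *)
Lemma cvg_reflection0 : reflection y @[y --> (0 : R)^'] --> pi.
Proof.
have hs : y^-1 * sin (y * pi) @[y --> (0 : R)^'] --> pi.
  apply: (@cvg_diff_quotient _ (fun y => sin (y * pi))); first by rewrite mul0r sin0.
  have := @is_derive1_comp _ _ ( *%R^~ pi) 0 _ _ (is_derive_sin ((0 : R) * pi))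
    (is_derive_mulr_const 0 pi).
  by rewrite mul0r cos0 mul1r.
have hp : q `^ (- (y * (y - 1) / 2)) @[y --> (0 : R)] --> (1 : R).
  rewrite /powR; under eq_fun do rewrite (gt_eqF q0).
  have : - (y * (y - 1) / 2) * ln q @[y --> (0 : R)] --> - (0 * (0 - 1) / 2) * ln q.
    apply: cvgM; last exact: cvg_cst.
    apply: cvgN; apply: cvgM; last exact: cvg_cst.
    by apply: cvgM => //; apply: cvgB => //; exact: cvg_cst.
  rewrite !mul0r oppr0 mul0r -expR0 => h.
  by apply: continuous_cvg h; exact: continuous_expR.
have lnq0 : - ln q != 0 by rewrite oppr_eq0 lt_eqF// lnq_lt0.
have : (y^-1 * sin (y * pi)) / (y^-1 * (1 - q `^ y)) * q `^ (- (y * (y - 1) / 2)) *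
    ln q^-1 / (qpoch_pow (1 + y) * qpoch_pow (1 - y) / qpoch_pow 1 ^+ 2) @[y --> (0 : R)^'] -->
    pi / - ln q * 1 * ln q^-1 / 1.
  apply: cvg_quot; first exact: oner_neq0.
    apply: cvgM; last exact: cvg_cst.
    apply: cvgM; last exact: (cvg_dnbhs_of hp).
    by apply: cvg_quot => //; exact: cvg_1B_powR.
  exact: (cvg_dnbhs_of cvg_qpoch_pow_pair).
rewrite divr1 mulr1 lnV ?posrE// divfK//.
apply: cvg_trans; apply: near_eq_cvg.
near=> y; have y0 : y != 0 by near: y; exact: nbhs_dnbhs_neq.
have : `|y| < 1 by near: y; exact: dnbhs0_lt.
rewrite ltr_norml => /andP[yl yr].
rewrite /reflection (qpoch_pow_shift y) (addrC y 1) [pi * y]mulrC lnV ?posrE//.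
have w0 : 1 - q `^ y != 0 by rewrite subr_eq0 eq_sym powR_neq1.
have nz z : 0 < z -> qpoch_pow z != 0.
  by move=> z0; apply: qpoch_pow_neq0 => k; rewrite gt_eqF// ltr_wpDr.
have [p1 p2] : 0 < 1 + y /\ 0 < 1 - y by split; lra.
by field; rewrite !nz// w0 y0.
Unshelve. all: by end_near.
Qed.

End QPochhammer.

(** * The reflection function *)

Section ReflectionBound.
Variable R : realType.
Implicit Types x y s u d : R.

Lemma dist_expR1_le d e : `|d| <= e -> `|expR d - 1| <= e * expR e :> R.
Proof.
move=> de; have e0 : 0 <= e by rewrite (le_trans _ de).
have h1 : expR e - 1 <= e * expR e.
  have := expR_ge1Dx (- e); rewrite expRN => h.
  have : (1 - e) * expR e <= (expR e)^-1 * expR e by rewrite ler_wpM2r ?expR_ge0.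
  by rewrite mulVf ?gt_eqF ?expR_gt0//; lra.
have h2 := expR_ge1Dx d; have h3 := expR_ge1Dx e.
move: de; rewrite !ler_norml => /andP[d1 d2].
have : expR d <= expR e by rewrite ler_expR.
by move=> h4; apply/andP; split; lra.
Qed.

Variable q : R.
Hypotheses (q0 : 0 < q) (q1 : q < 1).

Let t : R := - ln q.
Let lam : R := 2 * pi / t.

Let t0 : 0 < t. Proof. by rewrite oppr_gt0 ln_lt0// q0. Qed.

Let lam0 : 0 < lam. Proof. by rewrite divr_gt0// mulr_gt0// pi_gt0. Qed.

(** The choice of [lam] makes [2 pi u / lam] equal to [u * t], which turns the hyperbolic rows into
    q-factors. *)
Lemma sinh2_powR u : sinh2 lam u = (1 - q `^ u) ^+ 2 * q `^ (- u).
Proof.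
rewrite /sinh2 /ch2 (_ : 2 * pi * (u / lam) = - u * ln q); last first.
  have pi0 : (pi : R) != 0 by rewrite gt_eqF// pi_gt0.
  have lnq0 : ln q != 0 by rewrite lt_eqF// lnq_lt0.
  rewrite /lam /t; move: (pi : R) (ln q) pi0 lnq0 => p l p0 l0.
  by field; rewrite p0 l0.
have e v : q `^ v = expR (v * ln q) by rewrite /powR (gt_eqF q0).
rewrite !e -mulNr opprK; have := expRxMexpNx_1 (u * ln q); rewrite -mulNr.
move: (expR _) (expR _) => v w vw.
by ring: vw.
Qed.

Lemma sinh2_ratio_powR c s : 0 < c ->
  sinh2_ratio lam c s = ((1 - q `^ (c + s)) * (1 - q `^ (c - s)) / (1 - q `^ c) ^+ 2) ^+ 2.
Proof.
move=> c0; rewrite /sinh2_ratio !sinh2_powR.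
have qc : 1 - q `^ c != 0 by rewrite subr_eq0 eq_sym powR_neq1// lt0r_neq0.
have D x y : q `^ (x + y) = q `^ x * q `^ y by rewrite powRD// (gt_eqF q0) implybT.
have h : q `^ (- (c + s)) * q `^ (- (c - s)) = q `^ (- c) ^+ 2.
  by rewrite expr2 -!D; congr (q `^ _); ring.
have p0 : q `^ (- c) != 0 by rewrite gt_eqF// powR_gt0.
move: h (1 - q `^ (c + s)) (1 - q `^ (c - s)) (1 - q `^ c) qc p0.
move: (q `^ (- (c + s))) (q `^ (- (c - s))) (q `^ (- c)) => a b d h A B C C0 d0.
rewrite (_ : A ^+ 2 * a * (B ^+ 2 * b) = A ^+ 2 * B ^+ 2 * d ^+ 2); last by ring: h.
by field; rewrite C0 d0.
Qed.

Definition qpoch_pow_ratio s : R :=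
  (qpoch_pow q (2^-1 + s) * qpoch_pow q (2^-1 - s) / qpoch_pow q 2^-1 ^+ 2) ^+ 2.

Let qpo_half_neq0 s : `|s| < 2^-1 \/ s = 1 ->
  qpoch_pow q (2^-1 + s) != 0 /\ qpoch_pow q (2^-1 - s) != 0.
Proof.
move=> hs; split; apply: qpoch_pow_neq0 => // k; have [h1 h2] := half_int_neq0 k hs.
  by rewrite (_ : _ + k%:R = half_int R k + s)// /half_int; ring.
by rewrite (_ : _ + k%:R = half_int R k - s)// /half_int; ring.
Qed.

Let qpo_half0 : qpoch_pow q 2^-1 != 0.
Proof.
by have [] := @qpo_half_neq0 0 _; rewrite ?addr0//; left; rewrite normr0.
Qed.

Lemma cvg_ln_sinh2_ratio s : `|s| < 2^-1 \/ s = 1 ->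
  (fun K => \sum_(0 <= k < K) ln (sinh2_ratio lam (half_int R k) s)) @ \oo -->
  ln (qpoch_pow_ratio s).
Proof.
move=> hs; have [n1 n2] := qpo_half_neq0 hs.
apply: cvg_ln_sum.
- move=> k; have [? ?] := half_int_neq0 k hs; have c0 := half_int_gt0 R k.
  by rewrite divr_gt0 ?mulr_gt0 ?exprn_gt0 ?sinh2_gt0//; exact: lt0r_neq0.
- by rewrite lt0r sqr_ge0 andbT expf_neq0// mulf_neq0// ?mulf_neq0// invr_neq0// expf_neq0.
rewrite (_ : (fun K => _) = fun K =>
    (\prod_(0 <= k < K) (1 - q `^ (k%:R + (2^-1 + s))) *
     \prod_(0 <= k < K) (1 - q `^ (k%:R + (2^-1 - s))) /
     (\prod_(0 <= k < K) (1 - q `^ (k%:R + 2^-1)) *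
      \prod_(0 <= k < K) (1 - q `^ (k%:R + 2^-1)))) *
    (\prod_(0 <= k < K) (1 - q `^ (k%:R + (2^-1 + s))) *
     \prod_(0 <= k < K) (1 - q `^ (k%:R + (2^-1 - s))) /
     (\prod_(0 <= k < K) (1 - q `^ (k%:R + 2^-1)) *
      \prod_(0 <= k < K) (1 - q `^ (k%:R + 2^-1))))).
  rewrite /qpoch_pow_ratio !expr2.
  by apply: cvgM; (apply: cvg_quot; [by rewrite mulf_neq0| |]);
    apply: cvgM; exact: cvg_qpoch_pow.
apply/funext => K; rewrite -!big_split/= -prodf_div -big_split/=.
apply: eq_bigr => k _; rewrite sinh2_ratio_powR ?half_int_gt0//.
by rewrite /half_int -!addrA !expr2.
Qed.

(** The infinite products telescope to [(1 - q^(-1/2)) / (1 - q^(1/2)) = - q^(-1/2)], whose square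
    is [q^-1]. This is the source of the Gaussian power of [q]. *)
Lemma ln_qpoch_pow_ratio1 : ln (qpoch_pow_ratio 1) = t.
Proof.
have [n1 n2] := qpo_half_neq0 (or_intror (erefl (1 : R))).
have e1 : qpoch_pow q 2^-1 = (1 - q `^ 2^-1) * qpoch_pow q (2^-1 + 1) by rewrite qpoch_pow_shift.
have e2 : qpoch_pow q (2^-1 - 1) = (1 - q `^ (2^-1 - 1)) * qpoch_pow q 2^-1.
  by rewrite qpoch_pow_shift// subrK.
have h : q `^ (2^-1 - 1) = (q `^ 2^-1)^-1.
  by rewrite -powRN; congr (q `^ _); lra.
have hq : (q `^ 2^-1) ^+ 2 = q.
  rewrite -powR_mulrn ?powR_ge0// -powRrM mulVf ?powRr1 ?(ltW q0)//.
have nz : q `^ 2^-1 != 1 by rewrite powR_neq1.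
have nz0 : q `^ 2^-1 != 0 by rewrite gt_eqF// powR_gt0.
rewrite /t -lnV ?posrE// -hq; congr ln.
rewrite /qpoch_pow_ratio e2 e1 h; move: n1 nz nz0.
move: (q `^ 2^-1) (qpoch_pow q (2^-1 + 1)) => z P P0 z1 z0.
have z1' : 1 - z != 0 by rewrite subr_eq0 eq_sym.
by field; rewrite P0 z0 z1'.
Qed.

(** The value of [e^(-2 pi a)] at [a = lam]; column [m] then has [w = Q ^+ m]. *)
Let Q : R := expR (- (4 * pi ^+ 2 / t)).

Let Q01 : 0 < Q < 1.
Proof.
by rewrite expR_gt0 expR_lt1 oppr_lt0 divr_gt0// mulr_gt0// exprn_gt0// pi_gt0.
Qed.

(** The ratio is at most 1, so its inverse [1 + (2 - 2 c) / (w + 1 / w + 2 c)] is estimated, [c]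
    being the cosine. The numerator is at most 4 and the denominator at least
    [w + 1 / w - 2 = (1 - w)^2 / w]. *)
Lemma ln_theta_ratio_le m s : `|s| < 2^-1 ->
  `|ln (theta_ratio (lam * m.+1%:R) s)| <= 4 / (1 - Q) ^+ 2 * Q ^+ m.+1.
Proof.
move=> hs; have /andP[Q0 Q1] := Q01.
have chE : ch2 (lam * m.+1%:R) = Q ^+ m.+1 + (Q ^+ m.+1)^-1.
  rewrite /ch2 addrC -expRM_natl -expRN; congr (expR _ + expR _).
    by rewrite /lam; move: (pi : R) => p; field; rewrite gt_eqF.
  by rewrite /lam; move: (pi : R) => p; field; rewrite gt_eqF.
have w0 : 0 < Q ^+ m.+1 by rewrite exprn_gt0.
have w1 : Q ^+ m.+1 <= Q by rewrite exprS ger_pMr// exprn_ile1// ltW.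
have := cos_geN1 (2 * pi * s); have := cos_le1 (2 * pi * s).
rewrite /theta_ratio chE; move: (cos _) w0 w1 => c; move: (Q ^+ m.+1) => w w0 w1 c1 cN1.
have w1' : w < 1 by exact: le_lt_trans Q1.
have d0 : 0 < (1 - w) ^+ 2 / w by rewrite divr_gt0// exprn_gt0// subr_gt0.
have dE : w + w^-1 = 2 + (1 - w) ^+ 2 / w by field; rewrite gt_eqF.
have num0 : 0 < w + w^-1 + 2 * c by rewrite dE; lra.
have den0 : 0 < w + w^-1 + 2 by rewrite dE; lra.
have th0 : 0 < (w + w^-1 + 2 * c) / (w + w^-1 + 2) by rewrite divr_gt0.
rewrite ler0_norm; last first.
  by apply: ln_le0; rewrite ler_pdivrMr// mul1r; lra.
rewrite -lnV ?posrE// invf_div.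
have -> : (w + w^-1 + 2) / (w + w^-1 + 2 * c) = 1 + (2 - 2 * c) / (w + w^-1 + 2 * c).
  by move: (w + w^-1) num0 => v v0; field; rewrite gt_eqF.
rewrite (@le_trans _ _ ((2 - 2 * c) / (w + w^-1 + 2 * c)))//.
  by apply: le_ln1Dx; rewrite (lt_le_trans (ltrN10 _))// divr_ge0//; [lra|exact: ltW].
rewrite (@le_trans _ _ (4 / ((1 - w) ^+ 2 / w)))//.
  apply: ler_pM; [lra|by rewrite invr_ge0 ltW|lra|].
  by rewrite lef_pV2 ?posrE// dE; lra.
rewrite invf_div mulrCA mulrC ler_wpM2r ?(ltW w0)// ler_wpM2l//.
have p1 : 0 < 1 - w by rewrite subr_gt0.
have p2 : 0 < 1 - Q by rewrite subr_gt0.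
rewrite lef_pV2 ?posrE ?exprn_gt0// lerXn2r ?nnegrE ?(ltW p1) ?(ltW p2)//.
by rewrite lerD2l lerN2.
Qed.

Let Lam : R := 8 * Q / (1 - Q) ^+ 3.

(** Rows give the first two terms, by the value at [s = 1]. Columns give the squared cosine once,
    from [m = 0], and every [m >= 1] twice; the two sums over [m >= 1] are geometric, at most
    [Lam / 2] each. *)
Lemma ln_qpoch_pow_ratio_bound s : `|s| < 2^-1 ->
  `|ln (qpoch_pow_ratio s) - s ^+ 2 * t - ln (cos (pi * s) ^+ 2)| <= Lam.
Proof.
move=> hs; have /andP[Q0 Q1] := Q01.
have p2 : 0 < 1 - Q by rewrite subr_gt0.
have : (fun K => \sum_(0 <= k < K) (ln (sinh2_ratio lam (half_int R k) s) -
     s ^+ 2 * ln (sinh2_ratio lam (half_int R k) 1))) @ \oo --> ln (qpoch_pow_ratio s) - s ^+ 2 * t.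
  rewrite -ln_qpoch_pow_ratio1.
  under eq_fun do rewrite sumrB -mulr_sumr.
  by apply: cvgB_scale; apply: cvg_ln_sinh2_ratio; [left|right].
move/(double_defect_sum lam0 hs) => hY.
apply: (dist_cvg_le hY); near=> M.
have M0 : (0 < M)%N by near: M; exact: nbhs_infty_gt.
have sumQ n : \sum_(0 <= m < n) 4 / (1 - Q) ^+ 2 * Q ^+ m.+1 <= Lam / 2.
  under eq_bigr do rewrite [Q ^+ _]exprS mulrA.
  rewrite -mulr_sumr.
  rewrite (@le_trans _ _ (4 / (1 - Q) ^+ 2 * Q * (1 - Q)^-1))//.
    by rewrite ler_wpM2l ?sum_expr_le// mulr_ge0 ?(ltW Q0)// divr_ge0// sqr_ge0.
  by rewrite le_eqVlt /Lam; apply/orP; left; apply/eqP; field; rewrite gt_eqF.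
have sumT n : `|\sum_(0 <= m < n) ln (theta_ratio (lam * m.+1%:R) s)| <= Lam / 2.
  rewrite (le_trans (ler_norm_sum _ _ _))// (le_trans _ (sumQ n))//.
  by apply: ler_sum => m _; exact: ln_theta_ratio_le.
rewrite big_split/= -[M](prednK M0) big_nat_recl// mulr0.
have -> : theta_ratio 0 s = cos (pi * s) ^+ 2.
  rewrite /theta_ratio /ch2 mulr0 oppr0 expR0.
  rewrite (_ : 2 * pi * s = (pi * s) *+ 2); last by rewrite -[RHS]mulr_natr; ring.
  by rewrite cos_mulr2n -mulr_natr; field.
have := sumT M.-1; have := sumT M.-1.+1.
move: (\sum_(_ <= _ < _) _) (\sum_(_ <= _ < _) _) (ln _) => S1 S2 l h1 h2.
rewrite (_ : l + S1 + S2 - l = S1 + S2); last by ring.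
by rewrite (le_trans (ler_normD _ _))//; lra.
Unshelve. all: by end_near.
Qed.

Lemma qpoch_pow_gt0 x : 0 < x -> 0 < qpoch_pow q x.
Proof.
move=> x0; rewrite lt0r qpoch_pow_neq0//=; last by move=> k; rewrite gt_eqF// ltr_wpDr.
have h := @cvg_qpoch_pow _ _ q0 q1 x.
apply: (cvgr_to_ge h); apply: nearW => n; apply: prodr_ge0 => k _.
have : q `^ (k%:R + x) <= q `^ 0.
  by apply: ger_powR; rewrite ?q0 ?(ltW q1)// addr_ge0// ltW.
by rewrite powRr0 subr_ge0.
Qed.

Lemma reflection_gt0 x : 0 < x < 1 -> 0 < reflection q x.
Proof.
move=> /andP[x0 x1]; rewrite /reflection; apply: mulr_gt0.
  apply: mulr_gt0; last by rewrite lnV ?posrE.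
  apply: mulr_gt0; last exact: powR_gt0.
  by rewrite sin_gt0_pi// mulr_gt0 ?pi_gt0//= gtr_pMr// pi_gt0.
by rewrite divr_gt0 ?exprn_gt0 ?mulr_gt0 ?qpoch_pow_gt0 ?subr_gt0.
Qed.

(* The square of the common value that [reflection q] has, up to a factor close to 1,
   on ]0, 1[. *)
Definition reflection_cst : R :=
  q `^ 4^-1 * ln q^-1 ^+ 2 * (qpoch_pow q 1 ^+ 4 / qpoch_pow q 2^-1 ^+ 4).

(** In terms of [s = x - 1 / 2] the squared power of [q] has exponent [1 / 4 - s ^+ 2]; its part
    [- s ^+ 2] and the squared sine compensate exactly the main terms of
    [ln_qpoch_pow_ratio_bound]. *)
Lemma ln_reflection_bound x : 0 < x < 1 ->
  `|ln (reflection q x ^+ 2) - ln reflection_cst| <= Lam.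
Proof.
have [s ->] : exists s, x = 2^-1 + s by exists (x - 2^-1); ring.
move=> /andP[x0 x1]; have hs : `|s| < 2^-1 by rewrite ltr_norml; lra.
have [n1 n2] := qpo_half_neq0 (or_introl hs).
have q1p := @qpoch_pow_gt0 1 ltr01; have qhp : 0 < qpoch_pow q 2^-1 by rewrite qpoch_pow_gt0.
have t'E : ln q^-1 = t by rewrite lnV ?posrE.
have K0 : 0 < reflection_cst.
  by rewrite /reflection_cst t'E !mulr_gt0 ?powR_gt0 ?invr_gt0 ?exprn_gt0.
have G0 : 0 < qpoch_pow_ratio s.
  by rewrite lt0r sqr_ge0 andbT expf_neq0// mulf_neq0// ?mulf_neq0// invr_neq0// expf_neq0.
have c0 : 0 < cos (pi * s).
  have pi0 := pi_gt0 R; move: hs; rewrite ltr_norml => /andP[sl sr].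
  by apply: cos_gt0_pihalf; apply/andP; split; nra.
have sinE : sin (pi * (2^-1 + s)) = cos (pi * s).
  by rewrite mulrDr addrC sinDpihalf.
have e : reflection q (2^-1 + s) ^+ 2 =
    reflection_cst * cos (pi * s) ^+ 2 * q `^ (- s ^+ 2) / qpoch_pow_ratio s.
  have h : q `^ (- ((2^-1 + s) * (2^-1 + s - 1) / 2)) ^+ 2 = q `^ 4^-1 * q `^ (- s ^+ 2).
    rewrite -powR_mulrn ?powR_ge0// -powRrM -powRD; last by rewrite (gt_eqF q0) implybT.
    by congr (q `^ _); field.
  rewrite /reflection sinE !exprMn h /reflection_cst /qpoch_pow_ratio.
  rewrite (_ : 1 - (2^-1 + s) = 2^-1 - s); last by lra.
  move: n1 n2 (lt0r_neq0 q1p) (lt0r_neq0 qhp) (lt0r_neq0 c0).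
  move: (qpoch_pow q (2^-1 + s)) (qpoch_pow q (2^-1 - s)) (qpoch_pow q 1) (qpoch_pow q 2^-1).
  move=> a b P H a0 b0 P0 H0 _.
  by field; rewrite a0 b0 H0.
have lnp : ln (q `^ (- s ^+ 2)) = s ^+ 2 * t by rewrite ln_powR /t mulNr mulrN.
move: reflection_cst K0 e => K K0 ->.
have c2 : 0 < cos (pi * s) ^+ 2 by rewrite exprn_gt0.
have p0 : 0 < q `^ (- s ^+ 2) by rewrite powR_gt0.
have -> : ln (K * cos (pi * s) ^+ 2 * q `^ (- s ^+ 2) / qpoch_pow_ratio s) =
    ln K + ln (cos (pi * s) ^+ 2) + s ^+ 2 * t - ln (qpoch_pow_ratio s).
  have Kc : 0 < K * cos (pi * s) ^+ 2 by rewrite mulr_gt0.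
  rewrite ln_div ?posrE//; last by rewrite mulr_gt0.
  by rewrite lnM ?posrE// lnp lnM ?posrE.
rewrite distrC (_ : _ - _ =
  ln (qpoch_pow_ratio s) - s ^+ 2 * t - ln (cos (pi * s) ^+ 2)); last by ring.
exact: ln_qpoch_pow_ratio_bound.
Qed.

Lemma reflection_bound01 x : 0 < x < 1 -> `|pi - reflection q x| <= pi * (Lam * expR Lam).
Proof.
move=> x01; have pi0 := pi_gt0 R; have F0 := reflection_gt0 x01.
(* Letting the argument tend to 0 from the right identifies the unknown constant, up to the same
   error. *)
have hpi : `|ln (pi ^+ 2) - ln reflection_cst| <= Lam.
  have h : ln (reflection q y ^+ 2) @[y --> (0 : R)^'+] --> ln (pi ^+ 2 : R).
    have h : reflection q y @[y --> (0 : R)^'+] --> (pi : R).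
      apply: cvg_trans (cvg_reflection0 q0 q1); apply: cvg_app => P [r r0 hr].
      by exists r => // y ry y0; apply: (hr y ry); rewrite gt_eqF.
    apply: continuous_cvg; first by apply: continuous_ln; rewrite exprn_gt0.
    by under eq_fun do rewrite expr2; rewrite expr2; exact: cvgM.
  apply: (dist_cvg_le h); near=> y; apply: ln_reflection_bound.
  by apply/andP; split; near: y; [exact: nbhs_right_gt|exact: nbhs_right_lt].
have hx := ln_reflection_bound x01.
(* Two errors [Lam] for logarithms of squares add up to [2 * Lam]; removing the squares halves
   this. *)
have d : `|ln (reflection q x) - ln pi| <= Lam.
  move: hpi hx; rewrite !lnXn// !mulr2n !ler_norml => /andP[] + + /andP[].
  move: Lam (ln (reflection q x)) (ln pi) (ln reflection_cst) => L a b c h1 h2 h3 h4.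
  by apply/andP; split; lra.
have -> : pi - reflection q x = - (pi * (expR (ln (reflection q x) - ln pi) - 1)).
  rewrite expRB !lnK ?posrE//.
  by move: (pi : R) (reflection q x) (lt0r_neq0 pi0) => p F p0; field.
rewrite normrN normrM gtr0_norm// ler_wpM2l ?(ltW pi0)//.
exact: dist_expR1_le.
Unshelve. all: by end_near.
Qed.

Lemma reflection_bound x : x \isn't a Num.int -> `|pi - reflection q x| <= pi * (Lam * expR Lam).
Proof.
move=> xn; have /andP[f1 f2] := floor_itv x.
have := @reflectionDz _ q q0 q1 (x - (Num.floor x)%:~R) (Num.floor x).
rewrite subrK => ->; last by rewrite -mulrNz int_numDz.
apply: reflection_bound01; rewrite subr_gt0 lt_neqAle f1 andbT ltrBlDr addrC.
rewrite intrD1 in f2; rewrite f2 andbT.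
by apply: contraNneq xn => <-; exact: intr_int.
Qed.

Lemma cvg_reflection_int x : x \is a Num.int -> reflection q y @[y --> x^'] --> pi.
Proof.
move=> /intrP[n ->]; apply/cvgrPdist_le => e e0.
have /cvgrPdist_le/(_ e e0)[r /= r0 hr] := cvg_reflection0 q0 q1.
(* The radius 1 excludes all integers other than the centre. *)
exists (Num.min r 1); first by rewrite /= lt_min r0 ltr01.
move=> y /=; rewrite lt_min => /andP[yr y1] yn.
have yn0 : y - n%:~R != 0 by rewrite subr_eq0.
have nint : y - n%:~R \isn't a Num.int.
  apply/negP => /intrP[m mE]; move: y1 yn0; rewrite distrC mE.
  by rewrite -intr_norm -[1]/(1%:~R) ltr_int intr_eq0 -absz_eq0; case: (m) => [[|?]|?].
rewrite -[y](subrK n%:~R) reflectionDz//.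
by apply: hr => //=; rewrite sub0r normrN distrC.
Qed.

End ReflectionBound.

(** * Uniformity in [q] and the final estimate *)

(** As a function of [q], [Q] increases, so its value at [a] bounds it on the whole range and
    controls [(1 - Q) ^- 3]; and [Q = e^(4 pi^2 / ln q)] is below the required exponential. [0 <= C]
    stands under the conditions on [q] because the witness is known to be nonnegative once they
    force [a < 1]. *)
Lemma reflection_uniform_bound (R : realType) (a : R) : 0 < a ->
  exists C : R, forall q x : R, a < q -> q < 1 ->
    0 <= C /\ (x \isn't a Num.int -> `|pi - reflection q x| <= C * expR (pi ^+ 2 / ln q)).
Proof.
move=> a0; pose Q0 : R := expR (- (4 * pi ^+ 2 / - ln a)).
pose M := 8 / (1 - Q0) ^+ 3; exists (pi * (M * expR M)) => q x aq q1.
have pi0 := pi_gt0 R; have q0 : 0 < q by exact: lt_trans aq.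
have t0 : 0 < - ln q by rewrite oppr_gt0 ln_lt0// q0.
have tT : - ln q <= - ln a by rewrite lerN2 ler_ln ?posrE// ltW.
have T0 : 0 < - ln a by exact: lt_le_trans tT.
have p2 : 0 < 4 * pi ^+ 2 :> R by rewrite mulr_gt0// exprn_gt0.
have Q01 : Q0 < 1 by rewrite expR_lt1 oppr_lt0 divr_gt0.
have M0 : 0 <= M by rewrite divr_ge0// exprn_ge0// subr_ge0 ltW.
split; first by rewrite mulr_ge0 ?pi_ge0// mulr_ge0// expR_ge0.
move=> xn; apply: le_trans (reflection_bound q0 q1 xn) _.
set Q := expR (- (4 * pi ^+ 2 / - ln q)).
have Qgt0 : 0 < Q by exact: expR_gt0.
have QQ0 : Q <= Q0.
  by rewrite ler_expR lerN2 ler_wpM2l ?(ltW p2)// lef_pV2 ?posrE.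
have Q1 : Q <= 1 by rewrite (le_trans QQ0)// ltW.
have LM : 8 * Q / (1 - Q) ^+ 3 <= M * Q.
  rewrite mulrAC ler_wpM2r ?(ltW Qgt0)// ler_wpM2l//.
  have r0 : 0 < 1 - Q0 by rewrite subr_gt0.
  have r1 : 0 < 1 - Q by rewrite subr_gt0 (le_lt_trans QQ0).
  rewrite lef_pV2 ?posrE ?exprn_gt0// lerXn2r ?nnegrE ?(ltW r0) ?(ltW r1)//.
  by rewrite lerD2l lerN2.
have Qe : Q <= expR (pi ^+ 2 / ln q).
  have l0 : pi ^+ 2 / ln q <= 0.
    by rewrite pmulr_rle0 ?exprn_gt0// invr_le0 ltW// -oppr_gt0.
  by rewrite ler_expR invrN mulrN opprK -mulrA; lra.
rewrite -[leRHS]mulrA ler_wpM2l ?(ltW pi0)//.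
apply: (@le_trans _ _ (M * Q * expR M)).
  apply: ler_pM => //; rewrite ?expR_ge0//.
    by apply: divr_ge0; [rewrite mulr_ge0// ltW|rewrite exprn_ge0// subr_ge0].
  by rewrite ler_expR (le_trans LM)// ler_piMr.
by rewrite mulrAC ler_wpM2l// mulr_ge0// expR_ge0.
Qed.

Theorem corollary7p5 (R : realType) :
  exists C : R, forall q x : R, 4 * 10 ^- 13 < q -> q < 1 ->
    exists v w : R,
      [/\ extended_value (reflection_gamma q) x v,
          `|pi - v| <= C * expR (pi ^+ 2 / ln q),
          extended_value (reflection_prod q) x w
        & `|pi - w| <= C * expR (pi ^+ 2 / ln q)].
Proof.
have a0 : 0 < 4 * 10 ^- 13 :> R by rewrite mulr_gt0// invr_gt0 exprn_gt0.
have [C hC] := reflection_uniform_bound a0; exists C => q x aq q1.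
have [C0 bnd] := hC q x aq q1.
have q0 : 0 < q by exact: lt_trans aq.
have [xi|xi] := boolP (x \is a Num.int); last first.
  exists (reflection q x), (reflection q x); rewrite /extended_value (negbTE xi).
  by rewrite reflection_gammaE// reflection_prodE//; split=> //; exact: bnd.
(* Within distance 1 of the integer [x] there is no other integer, so [f] agrees with [reflection q]
   on a punctured neighbourhood. *)
have lim_ext (f : R -> R) : (forall y, y \isn't a Num.int -> f y = reflection q y) ->
    f y @[y --> x^'] --> (pi : R).
  move=> fE; apply: cvg_trans (cvg_reflection_int q0 q1 xi).
  apply: near_eq_cvg; near=> y; rewrite fE//.
  have yx : y != x by near: y; exact: nbhs_dnbhs_neq.
  have : `|x - y| < 1.
    by near: y; apply: nbhs_dnbhs; exact: (nbhsx_ballx x 1 ltr01).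
  rewrite distrC => yx1; apply/negP => yi.
  have : y - x \is a Num.int by rewrite rpredB.
  move=> /intrP[m mE]; move: yx1; rewrite mE.
  rewrite -intr_norm -[1]/(1%:~R) ltr_int => m1.
  have m0 : m = 0 by case: m m1 {mE} => [[|?]|?].
  by move: mE yx; rewrite m0 => /eqP; rewrite subr_eq0 => ->.
have e0 : `|pi - pi| <= C * expR (pi ^+ 2 / ln q) by rewrite subrr normr0 mulr_ge0// expR_ge0.
(* At an integer both extended values are pi and the error is 0. *)
exists pi, pi; rewrite /extended_value xi; split=> //; apply: lim_ext => y yn.
  exact: reflection_gammaE.
exact: reflection_prodE.
Unshelve. all: by end_near.
Qed.
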